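(* Let $m$ be a positive even integer. Then the following equalities hold in $\mathcal{A}_2$: $$\pounds_{\mathcal{A}_2,\{1\}^m}(2)=-\widetilde{\pounds}^{\star}_{\mathcal{A}_2,\{1\}^m}(2)=\left(\frac{m+1}{2^m}-m-2\right)\frac{B_{\mathbf{p}-m-1}}{m+1}\mathbf{p},$$ $$\widetilde{\pounds}_{\mathcal{A}_2,\{1\}^m}(1/2)=-\pounds^{\star}_{\mathcal{A}_2,\{1\}^m}(1/2)=\frac{1-2^{m+1}}{2^{m+1}}\,\frac{B_{\mathbf{p}-m-1}}{m+1}\mathbf{p}.$$
   Context: $\mathcal{A}_2=\left(\prod_p\mathbb{Z}/p^2\mathbb{Z}\right)/\left(\bigoplus_p\mathbb{Z}/p^2\mathbb{Z}\right)$, $p$ running over all primes. Elements are written $(a_p)_p$; two are equal iff their components agree for all but finitely many $p$ (so components may be undefined for finitely many $p$). $\mathbf{p}=(p\bmod p^2)_p$; $B_{\mathbf{p}-k}=(B_{p-k}\bmod p^2)_p$, with $B_n$ the Bernoulli numbers, $\frac{te^t}{e^t-1}=\sum_nB_n\frac{t^n}{n!}$. $\{1\}^m$ denotes $1$ repeated $m$ times. For a rational number $r\neq0$: $\pounds_{\mathcal{A}_2,\{1\}^m}(r)=\bigl(\sum_{p>n_1>\cdots>n_m>0}\frac{r^{n_1}}{n_1\cdots n_m}\bmod p^2\bigr)_p$, $\widetilde{\pounds}_{\mathcal{A}_2,\{1\}^m}(r)=\bigl(\sum_{p>n_1>\cdots>n_m>0}\frac{r^{n_m}}{n_1\cdots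 n_m}\bmod p^2\bigr)_p$, and $\pounds^{\star}_{\mathcal{A}_2,\{1\}^m}(r)$, $\widetilde{\pounds}^{\star}_{\mathcal{A}_2,\{1\}^m}(r)$ are defined by the same summands with the summation range replaced by $p-1\ge n_1\ge\cdots\ge n_m\ge1$. *)

(* Defs.v *)
From HB Require Import structures.
From mathcomp Require Import all_boot all_order all_algebra.
From mathcomp Require Import boolp classical_sets functions cardinality.
From mathcomp Require Import ring.

Set Implicit Arguments.
Unset Strict Implicit.
Unset Printing Implicit Defensive.
Import GRing.Theory Num.Theory.
Local Open Scope ring_scope.

Definition primes_t : Type := {p : nat | prime p}.

Lemma prime_sqr_gt1 (p : primes_t) : (1 < val p ^ 2)%N.
Proof. by rewrite -[1%N](exp1n 2) ltn_exp2r // prime_gt1 ?(valP p). Qed.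

Definition prodZp2 : Type := forall p : primes_t, 'Z_(val p ^ 2).

HB.instance Definition _ := Choice.on prodZp2.

Section ProdRing.
Implicit Types f g h : prodZp2.

Definition prod_zero : prodZp2 := fun=> 0.
Definition prod_one : prodZp2 := fun=> 1.
Definition prod_opp f : prodZp2 := fun p => - f p.
Definition prod_add f g : prodZp2 := fun p => f p + g p.
Definition prod_mul f g : prodZp2 := fun p => f p * g p.

Lemma prod_addA : associative prod_add.
Proof. by move=> f g h; apply: functional_extensionality_dep => p; apply: addrA. Qed.
Lemma prod_addC : commutative prod_add.
Proof. by move=> f g; apply: functional_extensionality_dep => p; apply: addrC. Qed.
Lemma prod_add0 : left_id prod_zero prod_add.
Proof. by move=> f; apply: functional_extensionality_dep => p; apply: add0r. Qed.
Lemma prod_addN : left_inverse prod_zero prod_opp prod_add.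
Proof. by move=> f; apply: functional_extensionality_dep => p; apply: addNr. Qed.
HB.instance Definition _ :=
  GRing.isZmodule.Build prodZp2 prod_addA prod_addC prod_add0 prod_addN.

Lemma prod_mulA : associative prod_mul.
Proof. by move=> f g h; apply: functional_extensionality_dep => p; apply: mulrA. Qed.
Lemma prod_mulC : commutative prod_mul.
Proof. by move=> f g; apply: functional_extensionality_dep => p; apply: mulrC. Qed.
Lemma prod_mul1 : left_id prod_one prod_mul.
Proof. by move=> f; apply: functional_extensionality_dep => p; apply: mul1r. Qed.
Lemma prod_mulD : left_distributive prod_mul prod_add.
Proof. by move=> f g h; apply: functional_extensionality_dep => p; apply: mulrDl. Qed.
Lemma prod_one_neq0 : prod_one != 0.
Proof.
apply/eqP => /(congr1 (fun f : prodZp2 => f (exist _ 2%N isT))) /eqP.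
by rewrite oner_eq0.
Qed.
HB.instance Definition _ := GRing.Zmodule_isComNzRing.Build prodZp2
  prod_mulA prod_mulC prod_mul1 prod_mulD prod_one_neq0.
End ProdRing.

Definition sumZp2 : {pred prodZp2} :=
  fun f => `[< finite_set [set p | f p != 0]%classic >].

Lemma infinite_primes : ~ finite_set [set: primes_t]%classic.
Proof.
move=> /finite_seqP[s sE].
have [q q_gt q_prime] := prime_above (\max_(p <- s) val p).
have : [set` s]%classic (exist _ q q_prime : primes_t) by rewrite -sE.
rewrite /= => q_in.
suff : (q <= \max_(p <- s) val p)%N by rewrite leqNgt q_gt.
by have := @leq_bigmax_seq _ s xpredT (fun p : primes_t => val p) _ q_in isT.
Qed.

Lemma sumZp2_idealr_closed : idealr_closed sumZp2.
Proof.
split.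
- apply/asboolP; rewrite (_ : mkset _ = set0) // -subset0 => p /=.
  by move/eqP.
- apply/asboolP => fin1; apply: infinite_primes.
  by apply: sub_finite_set fin1 => p _; apply: oner_neq0.
- move=> a f g /asboolP finf /asboolP fing; apply/asboolP.
  have : finite_set ([set p | f p != 0] `|` [set p | g p != 0])%classic.
    by rewrite finite_setU.
  apply: sub_finite_set => p /= fg_neq0; apply/orP; rewrite -negb_and.
  apply: contra fg_neq0 => /andP[/eqP fp0 /eqP gp0].
  by rewrite [X in X == _](_ : _ = a p * f p + g p)// fp0 gp0 mulr0 addr0.
Qed.

HB.instance Definition _ := isIdealr.Build prodZp2 sumZp2 sumZp2_idealr_closed.

Definition A2 : Type := {ideal_quot sumZp2}.

HB.instance Definition _ := GRing.ComNzRing.on A2.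

Definition A2_of (a : prodZp2) : A2 := (\pi_{ideal_quot sumZp2} a)%qT.

Lemma A2_of_is_zmod_morphism : zmod_morphism A2_of.
Proof. by move=> a b; rewrite /A2_of -rmorphB. Qed.

Lemma A2_of_is_monoid_morphism : monoid_morphism A2_of.
Proof.
by split=> [|a b]; rewrite /A2_of ?rmorph1 // -rmorphM.
Qed.

HB.instance Definition _ :=
  GRing.isZmodMorphism.Build prodZp2 A2 A2_of A2_of_is_zmod_morphism.
HB.instance Definition _ :=
  GRing.isMonoidMorphism.Build prodZp2 A2 A2_of A2_of_is_monoid_morphism.

Lemma A2_ofP (a b : prodZp2) :
  A2_of a = A2_of b <-> finite_set [set p | a p != b p]%classic.
Proof.
have -> : [set p | a p != b p]%classic = [set p | (a - b) p != 0]%classic.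
  by apply: funext => p /=; rewrite -(subr_eq0 (a p)).
split=> [/eqP | fin_ab].
  by rewrite /A2_of -Quotient.idealrBE => /asboolP.
by apply/eqP; rewrite /A2_of -Quotient.idealrBE; apply/asboolP.
Qed.

Lemma finite_primesP (P : set primes_t) :
  finite_set P <-> exists N, forall p, P p -> (val p < N)%N.
Proof.
split=> [/finite_seqP[s ->] | [N PN]].
  exists (\max_(p <- s) val p).+1 => p /= p_in.
  by rewrite ltnS; apply: leq_bigmax_seq p_in isT.
apply: (@sub_finite_set _ _ [set` pmap (insub : nat -> option primes_t) (iota 0 N)]%classic).
  move=> p /PN pN /=; rewrite mem_pmap_sub mem_iota; exact: pN.
exact: finite_seq.
Qed.

Lemma A2_of_eventuallyP (a b : prodZp2) :
  A2_of a = A2_of b <->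
  exists N, forall p : primes_t, (N <= val p)%N -> a p = b p.
Proof.
rewrite A2_ofP finite_primesP; split=> -[N abN]; exists N => p.
  by move=> Np; apply/eqP; apply: contraTT Np => /abN; rewrite ltnNge.
by move=> /= ab_neq; rewrite ltnNge; apply: contra ab_neq => /abN ->.
Qed.

(* The inverse in 'Z_(p ^ 2) is a junk value when p divides the denominator
   of x; the class in A2 of the resulting family does not depend on it. *)
Definition red (p : primes_t) (x : rat) : 'Z_(val p ^ 2) :=
  (numq x)%:~R / (denq x)%:~R.

Definition A2_of_rat (x : rat) : A2 := A2_of (fun p => red p x).

Lemma red_unit (p : primes_t) (d : int) :
  ~~ (val p %| `|d|)%N -> (d%:~R : 'Z_(val p ^ 2)) \is a GRing.unit.
Proof.
move=> p_ndvd; rewrite [d]intEsign rmorphM /= rmorph_sign unitrMl ?unitrX ?unitrN1 //.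
by rewrite unitZpE ?prime_sqr_gt1 // coprimeXl // prime_coprime ?(valP p).
Qed.

Lemma red_frac (p : primes_t) (a d : int) : ~~ (val p %| `|d|)%N ->
  red p (a%:~R / d%:~R) = a%:~R / d%:~R.
Proof.
move=> p_ndvd; have d_neq0 : d != 0 by apply: contraNneq p_ndvd => ->.
set x : rat := a%:~R / _.
have xE : numq x * d = a * denq x.
  apply: (@intr_inj rat); rewrite !rmorphM /=.
  have dx0 : (denq x)%:~R != 0 :> rat by rewrite intr_eq0 denq_eq0.
  have d0 : d%:~R != 0 :> rat by rewrite intr_eq0.
  apply: (mulIf (invr_neq0 dx0)); rewrite mulfK // mulrAC divq_num_den.
  by rewrite /x divfK.
have dvd_x : (denq x %| d)%Z.
  have : (denq x %| numq x * d)%Z by rewrite xE dvdz_mull.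
  by rewrite Gauss_dvdzr // coprimez_sym; apply: coprime_num_den.
have px_ndvd : ~~ (val p %| `|denq x|)%N.
  by apply: contra p_ndvd => /dvdn_trans; apply.
apply: (mulIr (red_unit px_ndvd)); rewrite /red divrK ?red_unit //.
by apply: (mulIr (red_unit p_ndvd)); rewrite mulrAC divrK ?red_unit // -!rmorphM /= xE.
Qed.

Lemma red_den (p : primes_t) (x y : rat) :
  (absz (denq x * denq y)%R < val p)%N ->
  ~~ (val p %| `|denq x|)%N /\ ~~ (val p %| `|denq y|)%N.
Proof.
move=> p_gt.
have : ~~ (val p %| absz (denq x * denq y)%R)%N.
  by rewrite gtnNdvd // absz_gt0 mulf_neq0 ?denq_eq0.
by rewrite abszM Euclid_dvdM ?(valP p) // negb_or => /andP.
Qed.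

Lemma A2_of_rat_is_zmod_morphism : zmod_morphism A2_of_rat.
Proof.
move=> x y; rewrite /A2_of_rat -rmorphB; apply/A2_of_eventuallyP.
exists (absz (denq x * denq y)).+1 => p p_gt; have [px py] := red_den p_gt.
have -> : x - y = (numq x * denq y - numq y * denq x)%:~R / (denq x * denq y)%:~R.
  rewrite -{1}[x]divq_num_den -{1}[y]divq_num_den rmorphB !rmorphM /=.
  by field; rewrite !intr_eq0 !denq_eq0.
rewrite red_frac; last by rewrite abszM Euclid_dvdM ?(valP p) // negb_or px.
have ux := red_unit px; have uy := red_unit py.
rewrite [RHS](_ : _ = red p x - red p y) // /red.
rewrite rmorphB !rmorphM /= invrM // [_^-1 * _^-1]mulrC mulrBl !mulrA.
by congr (_ - _); [rewrite mulrAC mulrK | rewrite mulrK].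
Qed.

Lemma A2_of_rat_is_monoid_morphism : monoid_morphism A2_of_rat.
Proof.
split.
  rewrite /A2_of_rat -(rmorph1 A2_of); congr A2_of.
  by apply: functional_extensionality_dep => p; rewrite /red divr1.
move=> x y; rewrite /A2_of_rat -rmorphM; apply/A2_of_eventuallyP.
exists (absz (denq x * denq y)).+1 => p p_gt; have [px py] := red_den p_gt.
have -> : x * y = (numq x * numq y)%:~R / (denq x * denq y)%:~R.
  rewrite -{1}[x]divq_num_den -{1}[y]divq_num_den !rmorphM /=.
  by rewrite mulf_div.
rewrite red_frac; last by rewrite abszM Euclid_dvdM ?(valP p) // negb_or px.
have ux := red_unit px; have uy := red_unit py.
rewrite [RHS](_ : _ = red p x * red p y) // /red.
by rewrite !rmorphM /= invrM // [_^-1 * _^-1]mulrC mulrACA.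
Qed.

HB.instance Definition _ :=
  GRing.isZmodMorphism.Build rat A2 A2_of_rat A2_of_rat_is_zmod_morphism.
HB.instance Definition _ :=
  GRing.isMonoidMorphism.Build rat A2 A2_of_rat A2_of_rat_is_monoid_morphism.

Definition A2_p : A2 := A2_of (fun p => (val p)%:R).

(* Comparing the coefficients of t ^ n.+1 in
   t e^t = (e^t - 1) * \sum_n B_n t^n / n! yields the recursion
   B_n = 1 - \sum_(k < n) 'C(n, k) B_k / (n + 1 - k); in particular
   B_1 = 1/2, see bernoulli_egf. *)
Fixpoint bernoulli_seq (n : nat) : seq rat :=
  if n is n'.+1 then
    let s := bernoulli_seq n' in
    rcons s (1 - \sum_(k < n') 'C(n', k)%:R * s`_k / (n'.+1 - k)%:R)
  else [::].

Definition bernoulli (n : nat) : rat := (bernoulli_seq n.+1)`_n.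

Lemma size_bernoulli_seq n : size (bernoulli_seq n) = n.
Proof. by elim: n => //= n IHn; rewrite size_rcons IHn. Qed.

Lemma nth_bernoulli_seq n k : (k < n)%N -> (bernoulli_seq n)`_k = bernoulli k.
Proof.
elim: n => // n IHn; rewrite ltnS leq_eqVlt => /predU1P[-> // | k_lt].
by rewrite /= nth_rcons size_bernoulli_seq k_lt IHn.
Qed.

Lemma bernoulliE n : bernoulli n =
  1 - \sum_(k < n) 'C(n, k)%:R * bernoulli k / (n.+1 - k)%:R.
Proof.
rewrite {1}/bernoulli /= nth_rcons size_bernoulli_seq ltnn eqxx.
by under eq_bigr => k _ do rewrite nth_bernoulli_seq //.
Qed.

(* Coefficient of t ^ n in t e^t = (e^t - 1) * \sum_n B_n t^n / n! *)
Lemma bernoulli_egf n :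
  (if n is n'.+1 then n'`!%:R^-1 else 0) =
  \sum_(k < n.+1) bernoulli k / k`!%:R *
    (if (n - k)%N is 0 then 0 else (n - k)`!%:R^-1) :> rat.
Proof.
have fact_neq0 k : k`!%:R != 0 :> rat by rewrite pnatr_eq0 -lt0n fact_gt0.
case: n => [|n]; first by rewrite big_ord1 mulr0.
rewrite big_ord_recr /= subnn mulr0 addr0.
have -> : \sum_(k < n.+1) bernoulli k / k`!%:R *
      (if (n.+1 - k)%N is 0 then 0 else (n.+1 - k)`!%:R^-1) =
    n`!%:R^-1 * \sum_(k < n.+1) 'C(n, k)%:R * bernoulli k / (n.+1 - k)%:R.
  rewrite mulr_sumr; apply: eq_bigr => k _.
  have k_le : (k <= n)%N by rewrite -ltnS.
  rewrite -(bin_fact k_le) !subSn // factS !natrM.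
  have : 'C(n, k)%:R != 0 :> rat by rewrite pnatr_eq0 -lt0n bin_gt0.
  have : (n - k).+1%:R != 0 :> rat by rewrite pnatr_eq0.
  move: (fact_neq0 k) (fact_neq0 (n - k)%N) => *.
  by field; apply/and4P; split=> //; rewrite nat1r.
rewrite [X in _ * X]big_ord_recr /= binn subSn // subnn mul1r divr1 bernoulliE.
by rewrite addrC subrK mulr1.
Qed.

(* Truncated subtraction only matters for the finitely many p < k. *)
Definition A2_bernoulli (k : nat) : A2 :=
  A2_of (fun p => red p (bernoulli (val p - k))).

(* With e := gtn: p > n_1 > ... > n_m > 0; with e := geq (and since each
   n_i < p): p - 1 >= n_1 >= ... >= n_m >= 1. *)
Definition index_set (e : rel nat) (p m : nat) : {set m.-tuple 'I_p} :=
  [set n : m.-tuple 'I_p |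
     sorted e [seq val i | i <- n] & all (fun i : 'I_p => 0 < i)%N n].

(* [head 0 s] and [last 0 s] are n_1 and n_m, as m > 0 in all uses. *)
Definition fmp_sum (e : rel nat) (expo : seq nat -> nat) (m : nat) (r : rat)
    (p : nat) : rat :=
  \sum_(n in index_set e p m)
    r ^+ expo [seq val i | i <- n] / \prod_(i <- n) (val i)%:R.

Definition polylog (m : nat) (r : rat) : A2 :=
  A2_of (fun p => red p (fmp_sum gtn (head 0%N) m r (val p))).

Definition polylog_tilde (m : nat) (r : rat) : A2 :=
  A2_of (fun p => red p (fmp_sum gtn (last 0%N) m r (val p))).

Definition polylog_star (m : nat) (r : rat) : A2 :=
  A2_of (fun p => red p (fmp_sum geq (head 0%N) m r (val p))).

Definition polylog_tilde_star (m : nat) (r : rat) : A2 :=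
  A2_of (fun p => red p (fmp_sum geq (last 0%N) m r (val p))).

(* Main.v *)
Require Import Defs.
From mathcomp Require Import all_boot all_order all_algebra.
From mathcomp Require Import ring zify.
Set Implicit Arguments.
Unset Strict Implicit.
Unset Printing Implicit Defensive.
Import GRing.Theory Num.Theory.
Local Open Scope ring_scope.

(** All four families are compared modulo p ^ 2 for one large prime p, in
    R = Z/p^2; v n denotes 1/n in R.

    The linear relations between the starred and unstarred sums come from
    E(-x) = \prod_(0 < j < p) (1 - x/j).  The generating function in x of the
    weakly decreasing sums, multiplied by E(-x), is up to sign that of the
    strictly decreasing ones at -x ([elsym_conv_nested], [elsym_conv_headsum]).
    Modulo p ^ 2 the coefficients of E(-x) of odd positive degree vanish, and
    those of even positive degree are multiples of p.  Since the starred sums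
    of even weight are themselves multiples of p, every cross term disappears
    for m even, leaving only the equality up to sign of the two sums.

    The values of the starred sums follow from duality.  By induction on the
    upper bound N, a weakly decreasing sum of weight m becomes a single sum
    over k of binomial coefficients C(N, k) times 1/k^m ([nested_exp_dual],
    [headsum_half_dual]).  For N = p - 1 one has
    C(p - 1, k) = (-1)^k (1 - p H_k), with H_k the harmonic number.  What
    remains are sums of 1/k^m over one parity class, and sums modulo p of
    weight m + 1 and depth at most two, some of them alternating.

    All of these are multiples of one number.  The sums
    D_k = \sum_j (1/j) (1^k + ... + j^k) satisfy, modulo p, the recursion of
    -B_k, hence p \sum_n H_n / n^m = p B_(p-1-m) ([pi_harm_sum]).  The same
    duality expresses the complete symmetric function h_m of the 1/j through
    this sum and the power sum P_m, while Newton's identity gives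
    m h_m = P_m; so (m + 1) P_m = m p B_(p-1-m) ([psum_bernoulli]).  Finally,
    the reflection n -> p - n and the doubling a -> 2a relate the sums over
    even, odd and small n, which determines each parity part of P_m
    ([even_part_bernoulli], [odd_part_bernoulli]) and the alternating double
    sum ([pi_alt_pair_sum]) in terms of B_(p-1-m). *)

(** * Nested sums and their generating-function identities *)

Section NestedSums.
Variables (R : comNzRingType) (u : nat -> R).
Implicit Types (b : nat -> nat) (F : nat -> R).

(** The outer index is below N, and [b n] is the bound for the index that
    follows the value n: [b := id] gives strictly decreasing sums and
    [b := succn] weakly decreasing ones.  F is evaluated at the bound left
    after the last index, so it can depend on that index. *)
Fixpoint nested b F k N : R :=
  if k is k'.+1 then \sum_(1 <= n < N) u n * nested b F k' (b n) else F N.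

Definition elsym := nested id (fun=> 1).
Definition hsym := nested succn (fun=> 1).
Definition psum k N : R := \sum_(1 <= n < N) u n ^+ k.

Lemma nested_small b F k N : (N <= 1)%N -> nested b F k.+1 N = 0.
Proof. by move=> N1; rewrite /= big_geq. Qed.

Lemma nestedS b F k N : nested b F k.+1 N.+2 =
  nested b F k.+1 N.+1 + u N.+1 * nested b F k (b N.+1).
Proof. by rewrite /= big_nat_recr. Qed.

Lemma nested0 b F N : nested b F 0 N = F N.
Proof. by []. Qed.

Lemma hsym1 N : hsym 1 N = psum 1 N.
Proof. by apply: eq_bigr => n _; rewrite /= mulr1. Qed.

Arguments nested : simpl never.

(** Coefficients of the generating function of hsym after the factor
    1 / (1 - u_(N+1) x) is split off. *)
Lemma hsym_geom m N :
  hsym m N.+2 = \sum_(i < m.+1) u N.+1 ^+ i * hsym (m - i) N.+1.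
Proof.
elim: m => [|m IHm]; first by rewrite big_ord1 expr0 mul1r.
rewrite big_ord_recl expr0 mul1r subn0 [LHS]nestedS -[nested _ _]/hsym IHm.
rewrite mulr_sumr; congr (_ + _); apply: eq_bigr => i _.
by rewrite exprS mulrA.
Qed.

(** Newton's identity.  Writing C(m, N) for the right-hand side, the recursion
    for hsym gives C(m, N + 1) - u C(m - 1, N + 1) = C(m, N) + u h_m(N + 1),
    with u the new variable, and the left-hand side satisfies the same. *)
Lemma newton_hsym m N :
  m.+1%:R * hsym m.+1 N = \sum_(i < m.+1) psum i.+1 N * hsym (m - i) N.
Proof.
have small k M : (M <= 1)%N ->
    k.+1%:R * hsym k.+1 M = \sum_(i < k.+1) psum i.+1 M * hsym (k - i) M.
  move=> M1; rewrite /hsym nested_small // mulr0 big1 // => i _.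
  by rewrite /psum big_geq ?mul0r.
case: N => [|N]; first exact: small.
elim: N m => [|N IHN] m; first exact: small.
have psumS i : psum i.+1 N.+2 = psum i.+1 N.+1 + u N.+1 ^+ i.+1.
  by rewrite /psum big_nat_recr.
have hS k : hsym k.+1 N.+2 = hsym k.+1 N.+1 + u N.+1 * hsym k N.+2 by exact: nestedS.
elim: m => [|m IHm].
  by rewrite big_ord1 mulr1 mul1r hsym1.
have -> : \sum_(i < m.+2) psum i.+1 N.+2 * hsym (m.+1 - i) N.+2 =
   u N.+1 * (\sum_(i < m.+1) psum i.+1 N.+2 * hsym (m - i) N.+2) +
   \sum_(i < m.+2) psum i.+1 N.+2 * hsym (m.+1 - i) N.+1.
  rewrite !(big_ord_recr m.+1) /= subnn addrA; congr (_ + _).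
  rewrite mulr_sumr -big_split; apply: eq_bigr => i _ /=.
  rewrite (subSn (leq_ord _)) hS; ring.
rewrite -IHm.
have -> : \sum_(i < m.+2) psum i.+1 N.+2 * hsym (m.+1 - i) N.+1 =
   \sum_(i < m.+2) psum i.+1 N.+1 * hsym (m.+1 - i) N.+1 + u N.+1 * hsym m.+1 N.+2.
  rewrite hsym_geom mulr_sumr -big_split; apply: eq_bigr => i _ /=.
  rewrite psumS exprS; ring.
rewrite -IHN [in LHS]hS hS; ring.
Qed.

(** With E(x) the generating function of the elementary symmetric functions,
    this is the identity of coefficients of E(-x) S(x) = -L(-x): weakly
    decreasing sums weighted by their last index against strictly decreasing
    ones weighted by their first.  The last index n of a weakly decreasing sum
    is seen by F as the bound n + 1.  Raising the bound by one adds a single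
    term on the right; on the left the contributions of the new index
    telescope to the same term. *)
Lemma elsym_conv_nested F m N :
  \sum_(k < m.+1) (-1) ^+ k * elsym k N * nested succn F (m.+1 - k) N =
  (-1) ^+ m * \sum_(1 <= n < N) u n * (F n.+1 * elsym m n).
Proof.
have small M : (M <= 1)%N ->
    \sum_(k < m.+1) (-1) ^+ k * elsym k M * nested succn F (m.+1 - k) M =
    (-1) ^+ m * \sum_(1 <= n < M) u n * (F n.+1 * elsym m n).
  move=> M1; rewrite (big_geq M1) mulr0 big1 // => k _.
  by rewrite (subSn (leq_ord _)) nested_small ?mulr0.
case: N => [|N]; first exact: small.
elim: N => [|N IHN]; first exact: small.
rewrite big_nat_recr // mulrDr -IHN /=.
have eS k : elsym k.+1 N.+2 = elsym k.+1 N.+1 + u N.+1 * elsym k N.+1 by exact: nestedS.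
have SS k : nested succn F k.+1 N.+2 =
   nested succn F k.+1 N.+1 + u N.+1 * nested succn F k N.+2 by exact: nestedS.
have -> : \sum_(k < m.+1) (-1) ^+ k * elsym k N.+2 * nested succn F (m.+1 - k) N.+2 =
  \sum_(k < m.+1) (-1) ^+ k * elsym k N.+1 * nested succn F (m.+1 - k) N.+2 -
  u N.+1 * \sum_(k < m) (-1) ^+ k * elsym k N.+1 * nested succn F (m - k) N.+2.
  rewrite big_ord_recl [in RHS]big_ord_recl -addrA; congr (_ + _).
  rewrite mulr_sumr -sumrB; apply: eq_bigr => i _ /=.
  rewrite /bump leq0n add1n subSS eS exprS; ring.
rewrite mulr_sumr !(big_ord_recr m) /= !subSn // subnn [in LHS]SS.
have -> : \sum_(k < m) (-1) ^+ k * elsym k N.+1 * nested succn F (m.+1 - k) N.+2 =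
  \sum_(k < m) (-1) ^+ k * elsym k N.+1 * nested succn F (m.+1 - k) N.+1 +
  \sum_(k < m) u N.+1 * ((-1) ^+ k * elsym k N.+1 * nested succn F (m - k) N.+2).
  rewrite -big_split; apply: eq_bigr => i _ /=.
  rewrite (subSn (ltnW (ltn_ord i))) SS; ring.
rewrite nested0.
ring.
Qed.

Lemma elsym_conv_hsym m N :
  \sum_(k < m.+1) (-1) ^+ k * elsym k N * hsym (m.+1 - k) N = (-1) ^+ m * elsym m.+1 N.
Proof.
rewrite elsym_conv_nested; congr (_ * _).
by apply: eq_bigr => n _; rewrite mul1r.
Qed.

Lemma elsym_conv_hsym0 m N :
  \sum_(k < m.+1) (-1) ^+ k * elsym k N * hsym (m - k) N = (m == 0%N)%:R.
Proof.
case: m => [|m]; first by rewrite big_ord1 /= !mulr1.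
rewrite big_ord_recr /= elsym_conv_hsym subnn mulr1 exprS; ring.
Qed.

(** The companion of [elsym_conv_nested] with the two weights exchanged.  The
    contribution of the new index N is proportional to the coefficient of
    E(-x) / E(-x), which is why [elsym_conv_hsym0] enters. *)
Lemma elsym_conv_headsum (F : nat -> R) m N :
  \sum_(k < m.+1) (-1) ^+ k * elsym k N *
     (\sum_(1 <= n < N) u n * (F n * hsym (m - k) n.+1)) =
  (-1) ^+ m * nested id F m.+1 N.
Proof.
have small M k : (M <= 1)%N ->
    \sum_(i < k.+1) (-1) ^+ i * elsym i M *
     (\sum_(1 <= n < M) u n * (F n * hsym (k - i) n.+1)) =
    (-1) ^+ k * nested id F k.+1 M.
  by move=> M1; rewrite nested_small // mulr0 big1 // => i _; rewrite big_geq ?mulr0.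
case: N => [|N]; first exact: small.
elim: N m => [|N IHN] m; first exact: small.
have eS k : elsym k.+1 N.+2 = elsym k.+1 N.+1 + u N.+1 * elsym k N.+1 by exact: nestedS.
under eq_bigr => k _ do rewrite big_nat_recr // mulrDr /=.
rewrite big_split /=.
have -> : \sum_(i < m.+1) (-1) ^+ i * elsym i N.+2 *
     (u N.+1 * (F N.+1 * hsym (m - i) N.+2)) = u N.+1 * F N.+1 * (m == 0%N)%:R.
  rewrite -(elsym_conv_hsym0 m N.+2) mulr_sumr; apply: eq_bigr => i _; ring.
rewrite nestedS.
case: m => [|m].
  rewrite mulrDr -IHN !big_ord1 subnn eqxx /elsym !nested0 !expr0 mulr1n; ring.
rewrite /= mulr0 addr0 mulrDr -IHN big_ord_recl [in RHS]big_ord_recl -addrA.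
congr (_ + _).
have -> : (-1) ^+ m.+1 * (u N.+1 * nested id F m.+1 N.+1) =
   - u N.+1 * ((-1) ^+ m * nested id F m.+1 N.+1) by rewrite exprS; ring.
rewrite -IHN mulr_sumr -big_split; apply: eq_bigr => i _ /=.
rewrite /bump leq0n add1n subSS eS exprS; ring.
Qed.
End NestedSums.

(** * Binomial transforms of the weakly decreasing sums *)

Section BinomialTransform.
Variable R : comUnitRingType.

Definition recip (n : nat) : R := n%:R^-1.

Variable N : nat.
Hypothesis unitN : forall n, (0 < n <= N)%N -> (n%:R : R) \is a GRing.unit.

Lemma recipK n : (0 < n <= N)%N -> n%:R * recip n = 1.
Proof. by move=> nN; apply: divrr; apply: unitN. Qed.

Lemma bin_recip M n : (M < N)%N -> (n <= M)%N ->
  'C(M, n)%:R * recip n.+1 = recip M.+1 * 'C(M.+1, n.+1)%:R.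
Proof.
move=> MN nM.
have := congr1 (fun k => k%:R * (recip n.+1 * recip M.+1)) (mul_bin_diag M.+1 n).
rewrite !natrM => binE.
have MK : M.+1%:R * recip M.+1 = 1 by apply: recipK; lia.
have nK : n.+1%:R * recip n.+1 = 1 by apply: recipK; lia.
rewrite -[LHS]mulr1 -[X in _ * X = _]MK.
transitivity (M.+1%:R * 'C(M, n)%:R * (recip n.+1 * recip M.+1)); first by ring.
rewrite binE -[RHS]mulr1 -[X in _ = _ * X]nK; ring.
Qed.

(** Iterating the sum over n <= N of (1/n) divides the k-th coefficient of a
    binomial transform by k, because C(N, k) - C(N-1, k) = C(N-1, k-1) and
    C(N-1, k-1) / k = C(N, k) / N. *)
Lemma nested_binomial (F c : nat -> R) :
  (forall n, (0 < n <= N)%N -> F n.+1 = \sum_(1 <= k < n.+1) 'C(n, k)%:R * c k) ->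
  forall m n, (0 < n <= N)%N -> nested recip succn F m n.+1 =
    \sum_(1 <= k < n.+1) 'C(n, k)%:R * (c k * recip k ^+ m).
Proof.
move=> FE; elim=> [|m IHm] n nN.
  by rewrite nested0 FE //; apply: eq_bigr => k _; rewrite expr0 mulr1.
elim: n nN => // n IHn nN.
have {}IHn : nested recip succn F m.+1 n.+1 =
    \sum_(1 <= k < n.+1) 'C(n, k)%:R * (c k * recip k ^+ m.+1).
  case: n nN {IHn} (IHn) => [|n] nN IHn; last by apply: IHn; lia.
  by rewrite nested_small // big_geq.
rewrite nestedS IHn IHm //.
have -> : \sum_(1 <= k < n.+1) 'C(n, k)%:R * (c k * recip k ^+ m.+1) =
    \sum_(1 <= k < n.+2) 'C(n, k)%:R * (c k * recip k ^+ m.+1).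
  by rewrite [RHS]big_nat_recr //= (@bin_small n n.+1) // mul0r addr0.
rewrite mulr_sumr -big_split; apply: eq_big_nat => -[//|k] kn /=; apply: esym.
transitivity (('C(n, k.+1)%:R * recip k.+1 + 'C(n, k)%:R * recip k.+1) *
    (c k.+1 * recip k.+1 ^+ m)); first by rewrite binS natrD exprS; ring.
rewrite bin_recip; [|lia|lia]; rewrite exprS; ring.
Qed.

Lemma sum_bin_exp (x : R) n :
  \sum_(1 <= k < n.+1) 'C(n, k)%:R * x ^+ k = (1 + x) ^+ n - 1.
Proof.
rewrite exprDn big_ord_recl subn0 expr1n expr0 bin0 mulr1 mulr1n addrC addrA addNr add0r.
rewrite big_add1 big_mkord; apply: eq_bigr => i _.
by rewrite /= /bump leq0n add1n expr1n mul1r mulr_natl.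
Qed.

(** For m = 0 the formula expands x ^ n = (1 - (1 - x)) ^ n; the division by
    powers of k is then [nested_binomial]. *)
Lemma nested_exp_dual (x : R) m n : (0 < n <= N)%N ->
  nested recip succn (fun i => x ^+ i.-1) m n.+1 =
  \sum_(1 <= k < n.+1)
    'C(n, k)%:R * (((1 - x) ^+ k - 1) * (-1) ^+ k * recip k ^+ m).
Proof.
move=> nN; apply: nested_binomial nN => i /andP[i_gt0 _] /=.
transitivity (\sum_(1 <= k < i.+1) 'C(i, k)%:R * (x - 1) ^+ k -
              \sum_(1 <= k < i.+1) 'C(i, k)%:R * (- 1) ^+ k).
  rewrite !sum_bin_exp subrr expr0n gtn_eqF //= subrKC; ring.
rewrite -sumrB; apply: eq_bigr => k _.
have -> : (x - 1) ^+ k = (1 - x) ^+ k * (-1) ^+ k.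
  by rewrite -exprMn_comm; [congr (_ ^+ _); ring | exact: mulrC].
ring.
Qed.

(** The case F = 1, where 1 = - \sum_(k > 0) C(n, k) (-1)^k for n > 0. *)
Lemma hsym_dual m n : (0 < n <= N)%N ->
  hsym recip m n.+1 = - \sum_(1 <= k < n.+1) 'C(n, k)%:R * ((-1) ^+ k * recip k ^+ m).
Proof.
move=> nN; rewrite -sumrN.
transitivity (\sum_(1 <= k < n.+1) 'C(n, k)%:R * (- (-1) ^+ k * recip k ^+ m)).
  apply: nested_binomial nN => i /andP[i_gt0 _].
  transitivity (- \sum_(1 <= k < i.+1) 'C(i, k)%:R * (- 1) ^+ k : R).
    by rewrite sum_bin_exp subrr expr0n gtn_eqF // sub0r opprK.
  by rewrite -sumrN; apply: eq_bigr => k _; ring.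
by apply: eq_bigr => k _; ring.
Qed.

Lemma sum_bin_tailS n j : (j <= n)%N ->
  (\sum_(j.+1 <= i < n.+2) 'C(n.+1, i) =
   2 * \sum_(j.+1 <= i < n.+1) 'C(n, i) + 'C(n, j))%N.
Proof.
move=> jn.
rewrite big_add1 /= (eq_bigr (fun i => 'C(n, i.+1) + 'C(n, i))%N) ?big_split //=.
rewrite -(big_add1 _ _ j n.+2 xpredT (fun i => 'C(n, i))) big_nat_recr //=.
rewrite bin_small // [X in (_ + X = _)%N](big_ltn (m := j)) //; lia.
Qed.

(** The tail sums of C(n, i) arise since 2^-n \sum_(i >= k) C(n, i) is the
    probability that the k-th success in fair coin tosses occurs within n
    tosses: its increment in n is 2^-n C(n-1, k-1), by [sum_bin_tailS], and
    C(n-1, k-1) / k = C(n, k) / n turns the sum over k into [hsym_dual]. *)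
Lemma headsum_half_dual m n : (n <= N)%N -> (2%:R : R) \is a GRing.unit ->
  2%:R ^+ n * \sum_(1 <= i < n.+1) recip i * (2%:R^-1 ^+ i * hsym recip m i.+1) =
  - \sum_(1 <= k < n.+1)
      (\sum_(k <= i < n.+1) 'C(n, i))%:R * ((-1) ^+ k * recip k ^+ m.+1).
Proof.
move=> + unit2; elim: n => [|n IHn] nN; first by rewrite !big_geq // mulr0 oppr0.
rewrite [\sum_(1 <= i < n.+2) recip _ * _]big_nat_recr //= mulrDr.
have -> : 2%:R ^+ n.+1 * (recip n.+1 * (2%:R^-1 ^+ n.+1 * hsym recip m n.+2)) =
    recip n.+1 * hsym recip m n.+2.
  transitivity ((2%:R * 2%:R^-1) ^+ n.+1 * (recip n.+1 * hsym recip m n.+2)).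
    by rewrite exprMn_comm; [ring | exact: mulrC].
  by rewrite divrr // expr1n mul1r.
rewrite exprS -mulrA IHn; last by lia.
rewrite hsym_dual; last by lia.
rewrite !mulrN -opprD; congr (- _).
have -> : \sum_(1 <= k < n.+1)
      (\sum_(k <= i < n.+1) 'C(n, i))%:R * ((-1) ^+ k * recip k ^+ m.+1) =
   \sum_(1 <= k < n.+2)
      (\sum_(k <= i < n.+1) 'C(n, i))%:R * ((-1) ^+ k * recip k ^+ m.+1).
  by rewrite [RHS]big_nat_recr //= (@big_geq _ _ _ n.+1) // mul0r addr0.
rewrite !mulr_sumr -big_split; apply: eq_big_nat => -[//|k] kn /=; apply: esym.
rewrite sum_bin_tailS; last by lia.
rewrite natrD natrM.
transitivity (2%:R * ((\sum_(k.+1 <= i < n.+1) 'C(n, i))%:R *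
   ((-1) ^+ k.+1 * recip k.+1 ^+ m.+1)) +
   ('C(n, k)%:R * recip k.+1) * ((-1) ^+ k.+1 * recip k.+1 ^+ m)).
  by rewrite [recip _ ^+ m.+1]exprS; ring.
by rewrite bin_recip; [ring|lia|lia].
Qed.
End BinomialTransform.

(** * Summation lemmas *)

Lemma sum_triangle (R : nmodType) (F : nat -> nat -> R) N :
  \sum_(1 <= n < N) \sum_(1 <= j < n.+1) F n j =
  \sum_(1 <= j < N) \sum_(j <= n < N) F n j.
Proof.
have [N1|] := leqP N 1; first by rewrite !(big_geq N1).
case: N => // N _; elim: N => [|N IHN]; first by rewrite !big_geq.
rewrite big_nat_recr // IHN /= [RHS]big_nat_recr //= big_nat1.
rewrite [X in _ + X = _]big_nat_recr //= addrA; congr (_ + _).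
rewrite -big_split; apply: eq_big_nat => j /andP[_ jN] /=.
by rewrite [RHS]big_nat_recr // ltnW.
Qed.

Section PowerSums.
Variable R : comNzRingType.

Definition npow k N : R := \sum_(1 <= n < N) n%:R ^+ k.

(** Telescoping of (n + 1)^(k+1) - n^(k+1). *)
Lemma sum_bin_npow k N : (0 < N)%N ->
  \sum_(i < k.+1) 'C(k.+1, i)%:R * npow i N = N%:R ^+ k.+1 - 1.
Proof.
move=> N_gt0.
have := telescope_sumr (fun n => n%:R ^+ k.+1 : R) N_gt0.
rewrite expr1n => <-.
under eq_bigr => i _ do rewrite /npow mulr_sumr.
rewrite exchange_big; apply: eq_bigr => n _ /=.
rewrite -nat1r exprDn (big_ord_recr k.+1) /= subnn expr0 mul1r binn mulr1n addrK.
by apply: eq_bigr => i _; rewrite expr1n mul1r mulr_natl.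
Qed.

Lemma npow0 N : (0 < N)%N -> npow 0 N = N%:R - 1.
Proof.
move=> N0; rewrite /npow; under eq_bigr do rewrite expr0.
by rewrite sumr_const_nat natrB.
Qed.
End PowerSums.

(** * Power sums modulo p ^ 2 *)

(** The hypotheses describe Z/p^2: the last one says that the ideal of
    elements annihilated by p has square zero, which is how a product of two
    multiples of p is seen to vanish.  A congruence modulo p between x and y
    is stated as p x = p y; the image of p is written pi. *)
Section ModPrimeSquare.
Variables (R : comUnitRingType) (p : nat).
Hypothesis p_pr : prime p.
Hypothesis natr_unit : forall n, (0 < n < p)%N -> (n%:R : R) \is a GRing.unit.
Hypothesis p_sq0 : (p%:R * p%:R : R) = 0.
Hypothesis ann_p_mul : forall x y : R, p%:R * x = 0 -> p%:R * y = 0 -> x * y = 0.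

Local Notation v := (recip R).
Local Notation pi := (p%:R : R).

Lemma natr_recip n : (0 < n < p)%N -> n%:R * v n = 1.
Proof. by move=> np; apply: divrr; apply: natr_unit. Qed.

Lemma pi_pi x : pi * (pi * x) = 0.
Proof. by rewrite mulrA p_sq0 mul0r. Qed.

Lemma unit_eq0 n (x : R) : (0 < n < p)%N -> n%:R * x = 0 -> x = 0.
Proof.
by move=> /natr_unit n_unit /(congr1 (fun y => n%:R^-1 * y)); rewrite mulKr // mulr0.
Qed.

Lemma unit_inj n (x y : R) : (0 < n < p)%N -> n%:R * x = n%:R * y -> x = y.
Proof. by move=> /natr_unit n_unit; apply: mulrI. Qed.

Lemma p_mul_mod (a b : nat) : a = b %[mod p] -> pi * a%:R = pi * b%:R.
Proof.
have modE c : pi * c%:R = pi * (c %% p)%:R.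
  by rewrite {1}(divn_eq c p) natrD natrM mulrDr [X in pi * X]mulrC pi_pi add0r.
by move=> ab; rewrite modE ab -modE.
Qed.

Lemma pi_fermat n : (0 < n < p)%N -> pi * n%:R ^+ p.-1 = pi.
Proof.
move=> np; apply: (unit_inj np).
rewrite mulrCA -exprS prednK ?prime_gt0 // -natrX.
by rewrite (p_mul_mod (fermat_little n p_pr)) mulrC.
Qed.

(** Fermat: modulo p, a negative power of n is the positive power with
    exponent increased by p - 1. *)
Lemma pi_pow_recip n k : (0 < n < p)%N -> (k <= p.-1)%N ->
  pi * v n ^+ k = pi * n%:R ^+ (p.-1 - k).
Proof.
move=> np kp; rewrite -{1}(pi_fermat np) -{1}(subnK kp) exprD -!mulrA.
by rewrite -exprMn natr_recip // expr1n mulr1.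
Qed.

(** By induction on k, [sum_bin_npow] at N = p shows that p divides
    (k + 1) \sum_n n^k. *)
Lemma pi_npow k : (0 < k < p.-1)%N -> pi * npow R k p = 0.
Proof.
elim/ltn_ind: k => k IHk kp.
have /(congr1 ( *%R pi)) := sum_bin_npow R k (prime_gt0 p_pr).
have -> : pi * (pi ^+ k.+1 - 1) = - pi.
  by rewrite mulrBr exprS pi_pi mulr1 sub0r.
case: k IHk kp => // k IHk kp.
rewrite big_ord_recr mulrDr mulr_sumr big_ord_recl big1 => [|i _]; last first.
  rewrite mulrCA IHk ?mulr0 //= /bump leq0n add1n; have := ltn_ord i; lia.
rewrite bin0 mul1r npow0 ?prime_gt0 // mulrBr p_sq0 mulr1 sub0r addr0.
rewrite binSn mulrCA => /eqP.
rewrite -subr_eq0 addrC addrA opprK subrr add0r => /eqP.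
by apply: unit_eq0; lia.
Qed.

Lemma pi_npow0 : pi * npow R 0 p = - pi.
Proof. by rewrite npow0 ?prime_gt0 // mulrBr p_sq0 sub0r mulr1. Qed.

Lemma pi_psum k : (0 < k < p.-1)%N -> pi * psum v k p = 0.
Proof.
move=> kp; rewrite -[RHS](@pi_npow (p.-1 - k)); last by lia.
rewrite !mulr_sumr; apply: eq_big_nat => n np.
by rewrite pi_pow_recip //; lia.
Qed.

(** * Harmonic sums and Bernoulli numbers *)

(** Up to sign these sums are the Bernoulli numbers modulo p; they are the D_k
    of the outline. *)
Definition harm_npow k : R := \sum_(1 <= j < p) v j * npow R k j.+1.

(** Summing the telescoped powers against 1/j leaves
    \sum_j ((j + 1)^(k+1) - 1) / j, a polynomial in j summed over 0 < j < p;
    modulo p only its constant term k + 1 contributes. *)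
Lemma harm_npow_rec k : (k < p.-1)%N ->
  pi * (\sum_(i < k.+1) 'C(k.+1, i)%:R * harm_npow i) = - (pi * k.+1%:R).
Proof.
move=> kp.
have -> : \sum_(i < k.+1) 'C(k.+1, i)%:R * harm_npow i =
    \sum_(1 <= j < p) v j * (j.+1%:R ^+ k.+1 - 1).
  rewrite /harm_npow; under eq_bigr do rewrite mulr_sumr.
  rewrite exchange_big; apply: eq_bigr => j _ /=.
  by rewrite -sum_bin_npow // mulr_sumr; apply: eq_bigr => i _; rewrite mulrCA.
have -> : \sum_(1 <= j < p) v j * (j.+1%:R ^+ k.+1 - 1) =
    \sum_(i < k.+1) 'C(k.+1, i.+1)%:R * npow R i p.
  rewrite /npow; under [RHS]eq_bigr do rewrite mulr_sumr.
  rewrite exchange_big; apply: eq_big_nat => j jp /=.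
  rewrite -nat1r exprDn big_ord_recl expr0 subn0 expr1n mulr1 mulr1n.
  rewrite [1 + _]addrC addrK mulr_sumr; apply: eq_bigr => i _.
  rewrite /= /bump leq0n add1n expr1n mul1r exprS -mulr_natl mulrCA.
  transitivity (j%:R * v j * ('C(k.+1, i.+1)%:R * j%:R ^+ i)); first by ring.
  by rewrite natr_recip // mul1r.
rewrite big_ord_recl bin1 mulrDr mulrCA pi_npow0 mulrN mulrC.
rewrite mulr_sumr big1 ?addr0 // => i _.
rewrite mulrCA pi_npow ?mulr0 //= /bump leq0n add1n; have := ltn_ord i; lia.
Qed.

(** beta k is the residue of the k-th Bernoulli number, with B_1 = 1/2; the
    recursion determines it for k < p - 1. *)
Variable beta : nat -> R.
Hypothesis betaE : forall k, (k < p.-1)%N ->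
  \sum_(i < k.+1) 'C(k.+1, i)%:R * beta i = k.+1%:R.

Lemma harm_npow_bernoulli k : (k < p.-1)%N -> pi * harm_npow k = - (pi * beta k).
Proof.
elim/ltn_ind: k => k IHk kp.
have := harm_npow_rec kp; rewrite -betaE // !big_ord_recr /= !mulrDr.
have -> : pi * (\sum_(i < k) 'C(k.+1, i)%:R * harm_npow i) =
    - (pi * (\sum_(i < k) 'C(k.+1, i)%:R * beta i)).
  rewrite !mulr_sumr -sumrN; apply: eq_bigr => i _.
  have ik := ltn_ord i; rewrite mulrCA IHk; [|lia|lia].
  by rewrite mulrN mulrCA.
rewrite opprD => /addrI; rewrite binSn mulrCA [pi * (k.+1%:R * _)]mulrCA.
rewrite -mulrN; apply: unit_inj; lia.
Qed.

Local Notation H n := (psum v 1 n.+1).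

(** Replace 1/n^m by n^(p-1-m) and sum over n >= j first: up to vanishing
    power sums this inner sum is -(1^k + ... + j^k) with k = p - 1 - m, so the
    double sum is -D_k. *)
Lemma pi_harm_sum m : (0 < m)%N -> (m.+2 < p)%N ->
  pi * \sum_(1 <= n < p) H n * v n ^+ m = pi * beta (p.-1 - m).
Proof.
move=> m_gt0 mp; set k := (p.-1 - m)%N.
have kp : (1 < k < p.-1)%N by lia.
apply: oppr_inj; rewrite -harm_npow_bernoulli; last by lia.
have -> : pi * (\sum_(1 <= n < p) H n * v n ^+ m) =
    pi * \sum_(1 <= n < p) H n * n%:R ^+ k.
  rewrite !mulr_sumr; apply: eq_big_nat => n np.
  by rewrite mulrCA pi_pow_recip; [rewrite mulrCA | lia | lia].
have -> : \sum_(1 <= n < p) H n * n%:R ^+ k =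
   \sum_(1 <= j < p) v j * (npow R k p - npow R k j.+1 + j%:R ^+ k).
  rewrite /psum; under eq_bigr do rewrite mulr_suml.
  rewrite (sum_triangle (fun n j => v j ^+ 1 * n%:R ^+ k)); apply: eq_big_nat => j jp.
  rewrite -mulr_sumr expr1; congr (_ * _).
  rewrite /npow (@big_cat_nat _ _ _ j 1 p) //=; [|lia|lia].
  rewrite [X in _ - X]big_nat_recr  /=; [ring | lia].
have -> : \sum_(1 <= j < p) v j * (npow R k p - npow R k j.+1 + j%:R ^+ k) =
    npow R k p * psum v 1 p - harm_npow k + npow R k.-1 p.
  rewrite /harm_npow /psum [npow R k.-1 p]/npow mulr_sumr -sumrB -big_split.
  apply: eq_big_nat => j jp /=; rewrite mulrDr; congr (_ + _); first by rewrite expr1; ring.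
  by rewrite -[in LHS](@prednK k) ?exprS ?mulrA; [rewrite [v j * _]mulrC natr_recip ?mul1r|lia].
rewrite !mulrDr mulrA pi_npow; last by lia.
rewrite pi_npow; last by lia.
by rewrite mul0r add0r addr0 mulrN opprK.
Qed.

Lemma ann_p_mull (x y : R) : pi * y = 0 -> pi * (x * y) = 0.
Proof. by move=> y0; rewrite mulrCA y0 mulr0. Qed.

(** * Reflection and symmetric functions of 1/1, ..., 1/(p-1) *)

Lemma recip_sub n : (0 < n < p)%N -> v (p - n) = - (v n + pi * v n ^+ 2).
Proof.
move=> np; apply: (@unit_inj (p - n)%N); first by lia.
rewrite natr_recip; last by lia.
have := natr_recip np; rewrite natrB; last by lia.
move=> nv.
transitivity (n%:R * v n + pi * v n * (n%:R * v n) - pi * v n - pi * (pi * v n ^+ 2)).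
  by rewrite pi_pi nv; ring.
ring.
Qed.

Lemma recip_sub_pow n k : (0 < n < p)%N ->
  v (p - n) ^+ k = (-1) ^+ k * (v n ^+ k + k%:R * pi * v n ^+ k.+1).
Proof.
move=> np; elim: k => [|k IHk]; first by rewrite !expr0; ring.
rewrite exprS IHk recip_sub //.
transitivity ((-1) ^+ k.+1 * (v n ^+ k.+1 + k.+1%:R * pi * v n ^+ k.+2) +
  (-1) ^+ k.+1 * (pi * (pi * (k%:R * v n ^+ k.+3)))); first by rewrite !exprS; ring.
by rewrite pi_pi mulr0 addr0.
Qed.

Lemma pi_recip_sub_pow n k : (0 < n < p)%N ->
  pi * v (p - n) ^+ k = (-1) ^+ k * (pi * v n ^+ k).
Proof.
move=> np; rewrite recip_sub_pow //.
transitivity ((-1) ^+ k * (pi * v n ^+ k) + (-1) ^+ k * (pi * (pi * (k%:R * v n ^+ k.+1)))).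
  ring.
by rewrite pi_pi mulr0 addr0.
Qed.

Hypothesis p_odd : odd p.

Lemma p_gt2 : (2 < p)%N.
Proof. by rewrite odd_prime_gt2. Qed.

(** Reflection n -> p - n gives 2 P_k = -k p P_(k+1) for k odd, and p divides
    P_(k+1). *)
Lemma psum_odd k : odd k -> (k.+2 < p)%N -> psum v k p = 0.
Proof.
move=> k_odd kp; apply: (@unit_eq0 2); first by have := p_gt2; lia.
have psumE : psum v k p = - psum v k p - k%:R * (pi * psum v k.+1 p).
  rewrite {1}/psum big_nat_rev /= -mulrN /psum !mulr_sumr -!sumrN mulr_sumr -big_split.
  apply: eq_big_nat => n np /=; rewrite add1n subSS recip_sub_pow // -signr_odd k_odd; ring.
have -> : 2%:R * psum v k p = psum v k p + psum v k p by ring.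
by rewrite {1}psumE pi_psum ?mulr0; [ring | lia].
Qed.

Local Notation h k := (hsym v k p).
Local Notation e k := (elsym v k p).

(** In Newton's identity every product P_i h_(k-i) with 0 < i < k is a product
    of two multiples of p. *)
Lemma hsym_psum k : (0 < k < p.-1)%N -> k%:R * h k = psum v k p /\ pi * h k = 0.
Proof.
elim/ltn_ind: k => -[//|k] IHk kp.
have hE : k.+1%:R * h k.+1 = psum v k.+1 p.
  rewrite newton_hsym big_ord_recr /= subnn mulr1 big1 ?add0r // => i _.
  have ik := ltn_ord i; apply: ann_p_mul; first by apply: pi_psum; lia.
  by apply: (proj2 (IHk _ _ _)); lia.
split=> //; apply: (@unit_eq0 k.+1); first by lia.
by rewrite mulrCA hE pi_psum.
Qed.

(** E(-x) times the generating function of hsym is 1, and products of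
    coefficients of positive degree vanish. *)
Lemma elsym_hsym k : (0 < k < p.-1)%N -> (-1) ^+ k * e k = - h k.
Proof.
elim/ltn_ind: k => -[//|k] IHk kp.
have := elsym_conv_hsym0 v k.+1 p; rewrite big_ord_recr big_ord_recl /=.
rewrite big1 => [|i _]; last first.
  have ik := ltn_ord i; rewrite /bump leq0n add1n; apply: ann_p_mul.
    have ip : (0 < i.+1 < p.-1)%N by lia.
    by rewrite IHk; [rewrite mulrN (proj2 (hsym_psum ip)) oppr0 | lia | lia].
  by apply: (proj2 (hsym_psum _)); lia.
rewrite subn0 subnn expr0 !mul1r addr0 mulr1 => /eqP.
by rewrite addrC addr_eq0 => /eqP.
Qed.

Lemma pi_elsym k : (0 < k < p.-1)%N -> pi * e k = 0.
Proof.
move=> kp; rewrite -[e k](signrMK (odd k)) signr_odd elsym_hsym //.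
by rewrite ann_p_mull // mulrN (proj2 (hsym_psum kp)) oppr0.
Qed.

Lemma elsym_odd k : odd k -> (k.+2 < p)%N -> e k = 0.
Proof.
move=> k_odd kp; have k_gt0 : (0 < k)%N by case: k k_odd {kp}.
have kp1 : (0 < k < p.-1)%N by lia.
rewrite -[e k](signrMK (odd k)) signr_odd elsym_hsym //.
have -> : h k = 0.
  by apply: (@unit_eq0 k); [lia | rewrite (proj1 (hsym_psum kp1)) psum_odd].
by rewrite oppr0 mulr0.
Qed.

(** In a convolution of even weight with the elementary symmetric functions
    only the term of degree 0 survives: odd degrees vanish, and in even
    degrees both factors are multiples of p. *)
Lemma elsym_conv_even (S : nat -> R) m : ~~ odd m.+1 -> (m.+3 < p)%N ->
  (forall j, (0 < j < m.+1)%N -> ~~ odd j -> pi * S j = 0) ->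
  \sum_(k < m.+1) (-1) ^+ k * e k * S (m.+1 - k)%N = S m.+1.
Proof.
move=> m_odd mp S0; rewrite big_ord_recl subn0 expr0 !mul1r big1 ?addr0 // => i _.
have im := ltn_ord i; rewrite /= /bump leq0n add1n.
have [i_odd|i_even] := boolP (odd i.+1).
  by rewrite elsym_odd ?mulr0 ?mul0r //; lia.
apply: ann_p_mul; first by rewrite ann_p_mull // pi_elsym //; lia.
by apply: S0; [lia | rewrite oddB; [rewrite (negPf m_odd) (negPf i_even) | lia]].
Qed.

(** C(p-1, n) = \prod_(j <= n) (p - j)/j. *)
Lemma bin_pred_prime n : (n < p)%N -> 'C(p.-1, n)%:R = (-1) ^+ n * (1 - pi * H n).
Proof.
elim: n => [|n IHn] np.
  by rewrite bin0 expr0 /psum big_geq // mulr0 subr0 mulr1.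
apply: (@unit_inj n.+1); first by lia.
have -> : n.+1%:R * 'C(p.-1, n.+1)%:R = (pi - n.+1%:R) * 'C(p.-1, n)%:R :> R.
  rewrite -natrB ?(ltnW np) // (_ : p - n.+1 = p.-1 - n)%N; last by lia.
  by rewrite -!natrM mul_bin_left.
rewrite IHn; last by lia.
have -> : H n.+1 = H n + v n.+1 by rewrite /psum big_nat_recr //= !expr1.
have nv : n.+1%:R * v n.+1 = 1 by apply: natr_recip; lia.
transitivity ((-1) ^+ n * (pi - n.+1%:R + pi * n.+1%:R * H n)
    - (-1) ^+ n * (pi * (pi * H n))); first by ring.
rewrite pi_pi.
transitivity ((-1) ^+ n * (pi * (n.+1%:R * v n.+1) - n.+1%:R + pi * n.+1%:R * H n)).
  by rewrite nv; ring.
rewrite exprS; ring.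
Qed.

(** Combine m h_m = P_m with the dual formula
    h_m = -\sum_n (1 - p H_n) / n^m = -P_m + p \sum_n H_n / n^m. *)
Lemma psum_bernoulli m : (0 < m)%N -> (m.+2 < p)%N ->
  m.+1%:R * psum v m p = m%:R * (pi * beta (p.-1 - m)).
Proof.
move=> m_gt0 mp; have mp1 : (0 < m < p.-1)%N by lia.
have hE : h m = - psum v m p + pi * beta (p.-1 - m).
  rewrite -pi_harm_sum // -{1}(prednK (prime_gt0 p_pr)).
  rewrite (@hsym_dual R p.-1) => [||]; [|move=> n np; apply: natr_unit; lia|lia].
  rewrite prednK ?prime_gt0 // mulr_sumr /psum -!sumrN -big_split.
  apply: eq_big_nat => n np /=; rewrite bin_pred_prime; last by lia.
  transitivity (((-1) ^+ n * (-1) ^+ n) * (- v n ^+ m + pi * (H n * v n ^+ m))); first ring.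
  by rewrite -signr_odd -signr_addb addbb mul1r.
have := congr1 ( *%R m%:R) hE; rewrite (proj1 (hsym_psum mp1)) mulrDr => mE.
transitivity (psum v m p + m%:R * psum v m p); first by ring.
rewrite {1}mE; ring.
Qed.

(** * Parity classes and halves of the interval *)

Lemma p_half : p = p./2.*2.+1.
Proof. by rewrite -[LHS]odd_double_half p_odd. Qed.

Local Notation q := p./2.

Lemma sum_even_odd (F : nat -> R) :
  \sum_(1 <= n < p) F n = \sum_(1 <= a < q.+1) (F a.*2 + F (p - a.*2)%N).
Proof.
rewrite big_split /= [X in _ + X]big_nat_rev /= [in LHS]p_half.
have -> : \sum_(1 <= a < q.+1) F (p - (1 + q.+1 - a.+1).*2)%N =
    \sum_(1 <= a < q.+1) F a.*2.-1.
  apply: eq_big_nat => a aq; congr (F _); have := p_half; lia.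
rewrite -big_split; elim: q => [|k IHk]; first by rewrite !big_geq.
rewrite doubleS big_nat_recr // big_nat_recr // [RHS]big_nat_recr //= -IHk.
by rewrite -addrA [F k.*2.+1 + _]addrC.
Qed.

Lemma sum_halves (F : nat -> R) :
  \sum_(1 <= n < p) F n = \sum_(1 <= a < q.+1) (F a + F (p - a)%N).
Proof.
have pq := p_half.
rewrite big_split (@big_cat_nat _ _ _ q.+1) //=; last by lia.
congr (_ + _); rewrite big_nat_rev -[q.+1 in LHS]add1n big_addn.
have -> : (p - q = q.+1)%N by lia.
by apply: eq_big_nat => a aq; congr (F _); lia.
Qed.

Lemma recip_double a : (0 < a < q.+1)%N -> v a.*2 = v 2 * v a.
Proof.
have pq := p_half; move=> aq; rewrite -mul2n /recip natrM invrM; first exact: mulrC.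
  by apply: natr_unit; have := p_gt2; lia.
by apply: natr_unit; lia.
Qed.

Local Notation Ev k := (\sum_(1 <= a < q.+1) v a.*2 ^+ k).
Local Notation Od k := (\sum_(1 <= a < q.+1) v (p - a.*2) ^+ k).

(** Doubling identifies the even part of a power sum with its first half. *)
Lemma even_psum k : 2%:R ^+ k * Ev k = psum v k q.+1.
Proof.
rewrite mulr_sumr; apply: eq_big_nat => a aq.
by rewrite recip_double // -exprMn mulrA natr_recip ?mul1r // p_gt2.
Qed.

Lemma psum_even_odd k : psum v k p = Ev k + Od k.
Proof. by rewrite /psum sum_even_odd big_split. Qed.

Lemma odd_even m : ~~ odd m -> Od m = Ev m + m%:R * (pi * Ev m.+1).
Proof.
move=> m_even; have pq := p_half.
rewrite !mulr_sumr -big_split; apply: eq_big_nat => a aq /=.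
rewrite recip_sub_pow; last by lia.
by rewrite -signr_odd (negPf m_even) expr0 mul1r mulrA.
Qed.

Lemma psum_halves m : ~~ odd m ->
  psum v m p = 2%:R * psum v m q.+1 + m%:R * (pi * psum v m.+1 q.+1).
Proof.
move=> m_even; have pq := p_half.
rewrite {1}/psum sum_halves /psum !mulr_sumr -big_split; apply: eq_big_nat => a aq /=.
rewrite recip_sub_pow; last by lia.
by rewrite -signr_odd (negPf m_even) expr0 mul1r; ring.
Qed.

Section EvenWeight.
Variable m : nat.
Hypotheses (m_gt0 : (0 < m)%N) (m_even : ~~ odd m) (mp : (m.+2 < p)%N).

Local Notation b := (pi * beta (p.-1 - m)).

(** P_m is computed by reflection twice, once pairing even with odd indices
    and once pairing the two halves; doubling makes the two answers
    comparable. *)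
Lemma psum_odd_part : psum v m p = 2%:R ^+ m.+1 * Od m.
Proof.
rewrite psum_halves // -!even_psum odd_even // !exprS; ring.
Qed.

Lemma pi_even_part : pi * Ev m = 0.
Proof.
have P0 : pi * psum v m p = 0 by apply: pi_psum; lia.
apply: (@unit_eq0 2); first by have := p_gt2; lia.
transitivity (pi * (Ev m + (Ev m + m%:R * (pi * Ev m.+1))) - m%:R * (pi * (pi * Ev m.+1))).
  by ring.
by rewrite -odd_even // -psum_even_odd P0 pi_pi mulr0 subr0.
Qed.

Lemma pi_half_psum : pi * psum v m q.+1 = 0.
Proof. by rewrite -even_psum ann_p_mull // pi_even_part. Qed.

Lemma odd_part_bernoulli : 2%:R ^+ m.+1 * (m.+1%:R * Od m) = m%:R * b.
Proof. by rewrite mulrCA -psum_odd_part psum_bernoulli. Qed.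

Lemma even_part_bernoulli :
  2%:R ^+ m.+1 * (m.+1%:R * Ev m) = (2%:R ^+ m.+1 - 1) * m%:R * b.
Proof.
have -> : Ev m = psum v m p - Od m by rewrite psum_even_odd addrK.
transitivity (2%:R ^+ m.+1 * (m.+1%:R * psum v m p) - 2%:R ^+ m.+1 * (m.+1%:R * Od m)).
  by ring.
rewrite odd_part_bernoulli psum_bernoulli //; ring.
Qed.

Lemma even_partS_bernoulli :
  2%:R ^+ m * (m.+1%:R * (pi * Ev m.+1)) = (1 - 2%:R ^+ m) * b.
Proof.
apply: (@unit_inj m); first by lia.
apply: (@unit_inj 2); first by have := p_gt2; lia.
transitivity (2%:R ^+ m.+1 * (m.+1%:R * (Od m - Ev m))).
  by rewrite odd_even // exprS; ring.
transitivity (2%:R ^+ m.+1 * (m.+1%:R * Od m) - 2%:R ^+ m.+1 * (m.+1%:R * Ev m)).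
  by ring.
rewrite odd_part_bernoulli even_part_bernoulli exprS; ring.
Qed.

(** Reflection turns the last n - 1 terms of H_(p-1), itself zero modulo p,
    into minus the first n - 1. *)
Lemma pi_harm_sub n : (0 < n < p)%N -> pi * H (p - n)%N = pi * (H n - v n).
Proof.
move=> np; have P0 : pi * psum v 1 p = 0 by apply: pi_psum; have := p_gt2; lia.
have -> : H n - v n = psum v 1 n.
  by rewrite /psum big_nat_recr /= ?expr1 ?addrK //; lia.
have : psum v 1 p = H (p - n)%N + \sum_(1 <= j < n) v (p - j) ^+ 1.
  rewrite /psum (@big_cat_nat _ _ _ (p - n).+1) //=; last by lia.
  congr (_ + _); rewrite big_nat_rev -add1n big_addn.
  have -> : (p - (p - n) = n)%N by lia.
  by apply: eq_big_nat => j jn; congr (v _ ^+ _); lia.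
move=> /(congr1 ( *%R pi)); rewrite P0 mulrDr => /eqP; rewrite eq_sym addr_eq0 => /eqP ->.
rewrite /psum !mulr_sumr -sumrN; apply: eq_big_nat => j jn.
rewrite pi_recip_sub_pow; [ring | lia].
Qed.

(** * The value at 2 *)

(** In the dual formula at x = 2 the factor (-1)^k - 1 keeps the odd k only.
    The sum of H_k / k^m over odd k is half the full sum, corrected by
    1/k^(m+1) over even k, by reflection. *)
Lemma tilde_star_odd_even :
  nested v succn (fun i => 2%:R ^+ i.-1) m p = - (2%:R * Od m) + b - pi * Ev m.+1.
Proof.
have pq := p_half.
rewrite -{1}(prednK (prime_gt0 p_pr)).
rewrite (@nested_exp_dual R p.-1) => [||]; [|move=> n np; apply: natr_unit; lia|lia].
rewrite prednK ?prime_gt0 //.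
transitivity (\sum_(1 <= k < p) (1 - pi * H k) * (((-1) ^+ k - 1) * v k ^+ m)).
  apply: eq_big_nat => k kp; rewrite bin_pred_prime; last by lia.
  rewrite (_ : 1 - 2%:R = -1 :> R); last by ring.
  have sK : (-1) ^+ k * (-1) ^+ k = 1 :> R by rewrite -signr_odd -signr_addb addbb.
  transitivity ((-1) ^+ k * (-1) ^+ k * ((1 - pi * H k) * (((-1) ^+ k - 1) * v k ^+ m))).
    by ring.
  by rewrite sK mul1r.
rewrite sum_even_odd -pi_harm_sum // [\sum_(1 <= n < p) _]sum_even_odd.
rewrite !mulr_sumr -!sumrN -!big_split; apply: eq_big_nat => a aq /=.
have s2 : (-1) ^+ a.*2 = 1 :> R by rewrite -signr_odd odd_double.
have sp : (-1) ^+ (p - a.*2) = -1 :> R.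
  by rewrite -signr_odd oddB; [rewrite p_odd odd_double expr1 | lia].
rewrite s2 sp subrr mul0r mulr0 add0r.
have Hs : pi * H (p - a.*2)%N = pi * (H a.*2 - v a.*2) by apply: pi_harm_sub; lia.
have W : pi * v (p - a.*2) ^+ m = pi * v a.*2 ^+ m.
  by rewrite pi_recip_sub_pow; [rewrite -signr_odd (negPf m_even) expr0 mul1r | lia].
have HW : pi * (H (p - a.*2)%N * v (p - a.*2) ^+ m) =
    pi * (H a.*2 - v a.*2) * v a.*2 ^+ m.
  by rewrite mulrCA W mulrCA mulrA Hs.
transitivity (- (2%:R * v (p - a.*2) ^+ m) + 2%:R * (pi * (H (p - a.*2)%N * v (p - a.*2) ^+ m))).
  by ring.
transitivity (- (2%:R * v (p - a.*2) ^+ m) + (pi * (H a.*2 * v a.*2 ^+ m) +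
   pi * (H (p - a.*2)%N * v (p - a.*2) ^+ m)) - pi * v a.*2 ^+ m.+1); last by ring.
rewrite !HW exprS; ring.
Qed.

Lemma pi_tilde_star : pi * nested v succn (fun i => 2%:R ^+ i.-1) m p = 0.
Proof.
rewrite tilde_star_odd_even odd_even //.
transitivity (- 2%:R * (pi * Ev m) + pi * (pi * (beta (p.-1 - m) - Ev m.+1 - 2%:R * m%:R * Ev m.+1))).
  by ring.
by rewrite pi_even_part pi_pi mulr0 addr0.
Qed.

Lemma tilde_star_bernoulli :
  2%:R ^+ m * (m.+1%:R * nested v succn (fun i => 2%:R ^+ i.-1) m p) =
  (2%:R ^+ m * m.+2%:R - m.+1%:R) * b.
Proof.
rewrite tilde_star_odd_even.
transitivity (- (2%:R ^+ m.+1 * (m.+1%:R * Od m)) + 2%:R ^+ m * m.+1%:R * b -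
   2%:R ^+ m * (m.+1%:R * (pi * Ev m.+1))); first by rewrite exprS; ring.
rewrite odd_part_bernoulli even_partS_bernoulli; ring.
Qed.

(** * Double sums and the value at 1/2 *)

Lemma sum2_split (f g : nat -> nat) (G : nat -> nat -> R) :
  (forall F : nat -> R, \sum_(1 <= n < p) F n = \sum_(1 <= a < q.+1) (F (f a) + F (g a))) ->
  \sum_(1 <= k < p) \sum_(1 <= i < p) G i k =
  \sum_(1 <= c < q.+1) \sum_(1 <= a < q.+1)
    (G (f a) (f c) + G (g a) (f c) + (G (f a) (g c) + G (g a) (g c))).
Proof.
move=> split; rewrite split; apply: eq_bigr => c _.
by rewrite !split -big_split.
Qed.

Definition pair_sum (s : nat -> nat -> R) : R :=
  \sum_(1 <= k < p) \sum_(1 <= i < p) (k < i)%:R * s i k * (v i * v k ^+ m).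

(** The inner sum over i > k is H_(p-1) - H_k, and p H_(p-1) = 0. *)
Lemma pi_pair_sum1 : pi * pair_sum (fun _ _ => 1) = - b.
Proof.
have -> : pair_sum (fun _ _ => 1) = \sum_(1 <= k < p) v k ^+ m * (psum v 1 p - H k).
  apply: eq_big_nat => k kp.
  have -> : psum v 1 p - H k = \sum_(k.+1 <= i < p) v i ^+ 1.
    by rewrite /psum (@big_cat_nat _ _ _ k.+1 1 p) //=; [rewrite addrAC subrr add0r|lia].
  rewrite [in LHS](@big_cat_nat _ _ _ k.+1 1 p) //=; last by lia.
  rewrite big_nat_cond big1 ?add0r => [|i /andP[ik _]]; last first.
    by rewrite ltnNge (_ : (i <= k)%N) ?mul0r //; lia.
  rewrite mulr_sumr; apply: eq_big_nat => i ik.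
  have -> : (k < i)%N by lia.
  by rewrite mulr1n; ring.
transitivity (psum v m p * (pi * psum v 1 p) - pi * \sum_(1 <= k < p) H k * v k ^+ m).
  rewrite [in RHS]mulrC -mulrA -mulrBr [psum v m p]/psum [in RHS]mulr_sumr -sumrB.
  by congr (_ * _); apply: eq_bigr => k _; ring.
rewrite pi_harm_sum //; have -> : pi * psum v 1 p = 0 by apply: pi_psum; have := p_gt2; lia.
by rewrite mulr0 sub0r.
Qed.

(** Modulo p, reflecting both indices of a pair reverses their order and
    changes the sign of 1 / (i k^m); hence a difference of two sums over pairs
    below p/2. *)
Definition half_pair_diff : R :=
  \sum_(1 <= c < q.+1) \sum_(1 <= a < q.+1)
    ((c < a)%:R - (a < c)%:R) * (v a * v c ^+ m).

(** Each of the two indices is a or p - a with a < p/2.  The pairs (i, k) with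
    k < p/2 < i contribute a product of two half power sums, and the one of
    even weight m is zero modulo p. *)
Lemma pi_pair_sum_halves : pi * pair_sum (fun _ _ => 1) = pi * half_pair_diff.
Proof.
have pq := p_half.
rewrite /pair_sum (sum2_split _ sum_halves).
transitivity (pi * half_pair_diff - pi * psum v m q.+1 * psum v 1 q.+1); last first.
  by rewrite pi_half_psum mul0r subr0.
rewrite /half_pair_diff /psum -mulrA -mulrBr mulr_suml -sumrB [LHS]mulr_sumr [RHS]mulr_sumr.
apply: eq_big_nat => c cq; rewrite [X in _ * (_ - X)]mulr_sumr -sumrB.
rewrite [LHS]mulr_sumr [RHS]mulr_sumr; apply: eq_big_nat => a aq.
have -> : (c < p - a)%N by lia.
have -> : (p - c < a)%N = false by lia.
have -> : (p - c < p - a)%N = (a < c)%N by lia.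
have Wa : pi * v (p - a) = - (pi * v a).
  by have := @pi_recip_sub_pow a 1; rewrite !expr1 mulN1r; apply; lia.
have Wc : pi * v (p - c) ^+ m = pi * v c ^+ m.
  by rewrite pi_recip_sub_pow; [rewrite -signr_odd (negPf m_even) expr0 mul1r | lia].
have Wac : pi * (v (p - a) * v (p - c) ^+ m) = - (pi * (v a * v c ^+ m)).
  by rewrite mulrCA Wc mulrCA mulrA Wa mulNr mulrA.
transitivity ((c < a)%:R * (pi * (v a * v c ^+ m)) + (pi * v (p - a)) * v c ^+ m +
   (a < c)%:R * (pi * (v (p - a) * v (p - c) ^+ m))).
  by rewrite /=; ring.
by rewrite Wac Wa; ring.
Qed.

(** The sign 1 + (-1)^(i+k) keeps the pairs of equal parity; these are doubles,
    or reflections of doubles, of pairs below p/2. *)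
Lemma pi_pair_sum_parity :
  2%:R ^+ m * (pi * pair_sum (fun i k => (-1) ^+ (i + k) + 1)) = pi * half_pair_diff.
Proof.
have pq := p_half.
rewrite /pair_sum (sum2_split _ sum_even_odd) /half_pair_diff !mulr_sumr.
apply: eq_big_nat => c cq; rewrite !mulr_sumr; apply: eq_big_nat => a aq.
have s_even n n' : ~~ odd (n + n') -> (-1) ^+ (n + n') = 1 :> R.
  by move=> /negPf nn; rewrite -signr_odd nn.
have s_odd n n' : odd (n + n') -> (-1) ^+ (n + n') = -1 :> R.
  by move=> nn; rewrite -signr_odd nn.
have pc_odd : odd (p - c.*2) by rewrite oddB; [rewrite p_odd odd_double | lia].
have pa_odd : odd (p - a.*2) by rewrite oddB; [rewrite p_odd odd_double | lia].
rewrite (s_even a.*2 c.*2) ?oddD ?odd_double //.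
rewrite (s_odd (p - a.*2)%N c.*2) ?oddD ?odd_double ?pa_odd //.
rewrite (s_odd a.*2 (p - c.*2)%N) ?oddD ?odd_double ?pc_odd //.
rewrite (s_even (p - a.*2)%N (p - c.*2)%N) ?oddD ?pa_odd ?pc_odd //.
rewrite ltn_double.
have -> : (p - c.*2 < p - a.*2)%N = (a < c)%N by lia.
have Wa : pi * v (p - a.*2) = - (pi * v a.*2).
  by have := @pi_recip_sub_pow a.*2 1; rewrite !expr1 mulN1r; apply; lia.
have Wc : pi * v (p - c.*2) ^+ m = pi * v c.*2 ^+ m.
  by rewrite pi_recip_sub_pow; [rewrite -signr_odd (negPf m_even) expr0 mul1r | lia].
have Wac : pi * (v (p - a.*2) * v (p - c.*2) ^+ m) = - (pi * (v a.*2 * v c.*2 ^+ m)).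
  by rewrite mulrCA Wc mulrCA mulrA Wa mulNr mulrA.
have K : 2%:R ^+ m.+1 * (v a.*2 * v c.*2 ^+ m) = v a * v c ^+ m.
  rewrite !recip_double // exprMn.
  transitivity ((2%:R * v 2) ^+ m.+1 * (v a * v c ^+ m)); last by rewrite natr_recip ?expr1n ?mul1r ?p_gt2.
  by rewrite exprMn !exprS; ring.
rewrite -K.
transitivity (2%:R ^+ m * (2%:R * (c < a)%:R * (pi * (v a.*2 * v c.*2 ^+ m)) +
   2%:R * (a < c)%:R * (pi * (v (p - a.*2) * v (p - c.*2) ^+ m)))).
  by ring.
rewrite Wac exprS; ring.
Qed.

Definition alt_pair_sum := pair_sum (fun i k => (-1) ^+ (i + k)).

(** The sums with signs 1 and 1 + (-1)^(i+k) are both governed by the same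
    double sum below p/2, so the second is 2^-m times the first. *)
Lemma pi_alt_pair_sum : 2%:R ^+ m * (pi * alt_pair_sum) = (2%:R ^+ m - 1) * b.
Proof.
have -> : alt_pair_sum =
    pair_sum (fun i k => (-1) ^+ (i + k) + 1) - pair_sum (fun _ _ => 1).
  rewrite -sumrB; apply: eq_bigr => k _; rewrite -sumrB; apply: eq_bigr => i _; ring.
rewrite !mulrBr pi_pair_sum_parity -pi_pair_sum_halves pi_pair_sum1; ring.
Qed.

Lemma bin_prime i : (0 < i < p)%N -> 'C(p, i)%:R = - (pi * ((-1) ^+ i * v i)) :> R.
Proof.
move=> ip; apply: (@unit_inj i) => //.
have := mul_bin_diag p i.-1; rewrite prednK; last by lia.
move=> /(congr1 (fun n => n%:R : R)); rewrite !natrM => <-.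
rewrite bin_pred_prime; last by lia.
transitivity (pi * (-1) ^+ i.-1 - (-1) ^+ i.-1 * (pi * (pi * H i.-1))); first by ring.
rewrite pi_pi mulr0 subr0 -[in RHS](@prednK i); last by lia.
transitivity (- (pi * (-1) ^+ i.-1.+1) * (i%:R * v i)); first by rewrite natr_recip // exprS; ring.
rewrite prednK; [ring | lia].
Qed.

(** Pascal's rule gives 2 \sum_(i >= k) C(p-1, i) + C(p-1, k-1) =
    \sum_(i >= k) C(p, i), and C(p, i) is explicit modulo p ^ 2. *)
Lemma bin_tail k : (0 < k < p)%N ->
  2%:R * ((\sum_(k <= i < p) 'C(p.-1, i))%:R * (-1) ^+ k) =
  1 + (-1) ^+ k -
    pi * (H k + \sum_(1 <= i < p) (k < i)%:R * (-1) ^+ (i + k) * v i) :> R.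
Proof.
move=> kp.
have tailE : (\sum_(k <= i < p.+1) 'C(p, i) =
    2 * \sum_(k <= i < p) 'C(p.-1, i) + 'C(p.-1, k.-1))%N.
  have := @sum_bin_tailS p.-1 k.-1; rewrite (prednK (prime_gt0 p_pr)).
  by rewrite prednK; [apply; lia | lia].
have := congr1 (fun n => n%:R : R) tailE.
rewrite natrD natrM big_nat_recr /=; last by lia.
rewrite binn bin_pred_prime; last by lia.
have -> : H k.-1 = H k - v k.
  by rewrite prednK; [rewrite /psum [in RHS]big_nat_recr /= ?expr1 ?addrK //; lia | lia].
rewrite natrD big_ltn; last by lia.
rewrite natrD bin_prime // natr_sum.
have -> : \sum_(k.+1 <= i < p) 'C(p, i)%:R =
    - (pi * \sum_(k.+1 <= i < p) (-1) ^+ i * v i).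
  rewrite mulr_sumr -sumrN; apply: eq_big_nat => i ik; apply: bin_prime; lia.
have -> : \sum_(1 <= i < p) (k < i)%:R * (-1) ^+ (i + k) * v i =
   (-1) ^+ k * \sum_(k.+1 <= i < p) (-1) ^+ i * v i.
  rewrite (@big_cat_nat _ _ _ k.+1 1 p) //=; last by lia.
  rewrite big_nat_cond big1 ?add0r => [|i /andP[ik _]]; last first.
    by rewrite ltnNge (_ : (i <= k)%N) ?mul0r //; lia.
  rewrite mulr_sumr; apply: eq_big_nat => i ik.
  have -> : (k < i)%N by lia.
  by rewrite mulr1n exprD; ring.
move: (\sum_(k.+1 <= i < p) _) => A.
have -> : (-1) ^+ k.-1 = - (-1) ^+ k :> R.
  by rewrite -{2}(@prednK k) ?exprS ?mulN1r ?opprK //; lia.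
move=> E; have sK : (-1) ^+ k * (-1) ^+ k = 1 :> R by rewrite -signr_odd -signr_addb addbb.
transitivity ((-1) ^+ k * (2%:R * (\sum_(k <= i < p) 'C(p.-1, i))%:R +
    - (-1) ^+ k * (1 - pi * (H k - v k)) + (-1) ^+ k * (1 - pi * (H k - v k)))).
  ring.
rewrite -E; move: (psum _ _ _) ((-1) ^+ k) sK => hk s sK.
transitivity (s * s * (1 - pi * hk) + s - pi * (s * A)); first by ring.
by rewrite sK; ring.
Qed.

Local Notation star_half := (\sum_(1 <= i < p) v i * (2%:R^-1 ^+ i * hsym v m.-1 i.+1)).

(** The dual formula computes 2^(p-1) times the sum.  It shows that the sum is
    a multiple of p, and then 2^(p-1) can be replaced by 1 by Fermat. *)
Lemma star_half_alt : 2%:R * star_half = - (2%:R * Ev m) + b + pi * alt_pair_sum.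
Proof.
have u2 : (2%:R : R) \is a GRing.unit by apply: natr_unit; rewrite p_gt2.
set S := star_half.
have SE : 2%:R ^+ p.-1 * S = - \sum_(1 <= k < p)
      (\sum_(k <= i < p) 'C(p.-1, i))%:R * ((-1) ^+ k * v k ^+ m).
  have := @headsum_half_dual R p.-1 _ m.-1 p.-1 (leqnn _) u2.
  rewrite (prednK (prime_gt0 p_pr)) (prednK m_gt0); apply => n np.
  by apply: natr_unit; lia.
have TE : 2%:R * (2%:R ^+ p.-1 * S) = - (2%:R * Ev m) + b + pi * alt_pair_sum.
  rewrite SE -pi_harm_sum // mulrN [in LHS]mulr_sumr.
  have -> : \sum_(1 <= k < p) 2%:R *
      ((\sum_(k <= i < p) 'C(p.-1, i))%:R * ((-1) ^+ k * v k ^+ m)) =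
    \sum_(1 <= k < p) (1 + (-1) ^+ k) * v k ^+ m -
    (pi * (\sum_(1 <= k < p) H k * v k ^+ m) + pi * alt_pair_sum).
    rewrite -mulrDr /alt_pair_sum /pair_sum -big_split [in RHS]mulr_sumr -sumrB.
    apply: eq_big_nat => k kp /=.
    rewrite mulrA mulrA -[2%:R * _ * _]mulrA bin_tail // mulrBl; congr (_ - _).
    rewrite -mulrA; congr (_ * _); rewrite mulrDl; congr (_ + _).
    by rewrite mulr_suml; apply: eq_bigr => i _; ring.
  have -> : \sum_(1 <= k < p) (1 + (-1) ^+ k) * v k ^+ m = 2%:R * Ev m.
    rewrite sum_even_odd mulr_sumr; apply: eq_big_nat => a aq.
    have pq := p_half.
    rewrite -signr_odd odd_double -[(-1) ^+ (p - _)]signr_odd.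
    rewrite oddB; last by lia.
    by rewrite p_odd odd_double /= expr1 expr0; ring.
  ring.
have S0 : pi * S = 0.
  apply: (@unit_eq0 2); first exact: p_gt2.
  have two_fermat : pi * 2%:R ^+ p.-1 = pi by apply: pi_fermat; rewrite p_gt2.
  rewrite -two_fermat.
  transitivity (pi * (2%:R * (2%:R ^+ p.-1 * S))); first by ring.
  rewrite TE.
  transitivity (- 2%:R * (pi * Ev m) + pi * (pi * (beta (p.-1 - m) + alt_pair_sum))).
    by ring.
  by rewrite pi_even_part pi_pi mulr0 addr0.
rewrite -TE; congr (_ * _); apply/eqP; rewrite -subr_eq0; apply/eqP.
rewrite (_ : _ - _ = (1 - 2%:R ^+ p.-1) * S); last by ring.
apply: ann_p_mul => //; rewrite mulrBr pi_fermat ?p_gt2 //; ring.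
Qed.

Lemma pi_star_half : pi * star_half = 0.
Proof.
apply: (@unit_eq0 2); first exact: p_gt2.
rewrite mulrCA star_half_alt.
transitivity (- 2%:R * (pi * Ev m) + pi * (pi * (beta (p.-1 - m) + alt_pair_sum))).
  by ring.
by rewrite pi_even_part pi_pi mulr0 addr0.
Qed.

Lemma star_half_bernoulli :
  2%:R ^+ m.+1 * (m.+1%:R * star_half) = (2%:R ^+ m.+1 - 1) * b.
Proof.
transitivity (2%:R ^+ m * (m.+1%:R * (2%:R * star_half))); first by rewrite exprS; ring.
rewrite star_half_alt.
transitivity (- (2%:R ^+ m.+1 * (m.+1%:R * Ev m)) + 2%:R ^+ m * m.+1%:R * b +
  m.+1%:R * (2%:R ^+ m * (pi * alt_pair_sum))); first by rewrite exprS; ring.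
rewrite even_part_bernoulli pi_alt_pair_sum exprS; ring.
Qed.
End EvenWeight.

(** * The relations between starred and unstarred sums *)

Lemma headsum_tilde_star m : (0 < m)%N -> ~~ odd m -> (m.+2 < p)%N ->
  \sum_(1 <= n < p) v n * (2%:R ^+ n * elsym v m.-1 n) =
  - nested v succn (fun i => 2%:R ^+ i.-1) m p.
Proof.
case: m => // m _ m_even mp; have m_odd : odd m by move: m_even; rewrite /= negbK.
have := elsym_conv_nested v (fun i => 2%:R ^+ i.-1) m p.
rewrite (@elsym_conv_even (fun j => nested v succn (fun i => 2%:R ^+ i.-1) j p)) //
  => [->|j jm j_even]; last by apply: pi_tilde_star => //; lia.
by rewrite -signr_odd m_odd expr1 mulN1r opprK.
Qed.

Lemma nested_headsum_star m : (0 < m)%N -> ~~ odd m -> (m.+2 < p)%N ->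
  nested v id (fun i => 2%:R^-1 ^+ i) m p =
  - \sum_(1 <= n < p) v n * (2%:R^-1 ^+ n * hsym v m.-1 n.+1).
Proof.
case: m => // m _ m_even mp; have m_odd : odd m by move: m_even; rewrite /= negbK.
have := elsym_conv_headsum v (fun i => 2%:R^-1 ^+ i) m p.
pose S j := \sum_(1 <= n < p) v n * (2%:R^-1 ^+ n * hsym v j.-1 n.+1).
rewrite (eq_bigr (fun k : 'I_m.+1 => (-1) ^+ k * elsym v k p * S (m.+1 - k)%N)) => [|k _]; last first.
  by rewrite /S (subSn (leq_ord k)).
rewrite (@elsym_conv_even S) // => [SE|j jm j_even]; last by apply: pi_star_half => //; lia.
by rewrite -[X in - X]/(S m.+1) SE -signr_odd m_odd expr1 mulN1r opprK.
Qed.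
End ModPrimeSquare.

(** * Sums over decreasing tuples as nested sums *)

Section TupleSums.
Variables (R : comNzRingType) (u : nat -> R) (p : nat).
Variables (e : rel nat) (b : nat -> nat).
Hypothesis e_trans : transitive e.
Hypothesis eE : forall n i, e n i = (i < b n)%N.
Hypothesis b_le : forall n, (b n <= n.+1)%N.

Local Notation vals t := [seq val i | i <- t].

(** The index bound N can be smaller than p, the size of the type of the
    entries, so that removing the first entry gives a sum of the same kind. *)
Definition tuple_sum (W : seq nat -> R) m N : R :=
  \sum_(t : m.-tuple 'I_p | sorted e (vals t) && all (fun i : 'I_p => 0 < i < N)%N t)
    W (vals t) * \prod_(i <- t) u i.

Lemma tuple_sum0 W N : tuple_sum W 0 N = W [::].
Proof.
rewrite /tuple_sum (big_pred1 [tuple]) => [|t]; last by rewrite tuple0 /= eqxx.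
by rewrite big_nil mulr1.
Qed.

(** Transitivity of e turns the condition on the first two entries into a
    bound on all the remaining ones. *)
Lemma tuple_sumS W m N : (N <= p)%N -> tuple_sum W m.+1 N =
  \sum_(1 <= n < N) u n * tuple_sum (fun s => W (n :: s)) m (b n).
Proof.
move=> Np; rewrite /tuple_sum.
rewrite (reindex (fun x : 'I_p * m.-tuple 'I_p => cons_tuple x.1 x.2)) /=; last first.
  exists (fun t : m.+1.-tuple 'I_p => (thead t, behead_tuple t)) => [[i t] _|t _].
    by rewrite theadE; congr pair; apply: val_inj.
  by case/tupleP: t => i t; rewrite theadE; apply: val_inj.
rewrite (eq_bigl (fun x : 'I_p * m.-tuple 'I_p => (0 < x.1 < N)%N &&
   (sorted e (vals x.2) && all (fun i : 'I_p => 0 < i < b x.1)%N x.2))); last first.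
  case=> i t /=; rewrite (path_sortedE e_trans) all_map.
  rewrite [RHS]andbCA -andbA [LHS]andbCA; congr (_ && _).
  have [iN|_] /= := boolP (0 < i < N)%N; last by rewrite andbF.
  rewrite -all_predI; apply: eq_all => j /=; rewrite eE.
  by have := b_le i; lia.
rewrite -(pair_big_dep (fun i : 'I_p => (0 < i < N)%N)
  (fun (i : 'I_p) (t : m.-tuple 'I_p) =>
     sorted e (vals t) && all (fun j : 'I_p => 0 < j < b i)%N t)
  (fun (i : 'I_p) (t : m.-tuple 'I_p) =>
     W (val i :: vals t) * \prod_(j <- i :: t) u j)) /=.
rewrite [RHS](big_nat_widen _ _ p) // big_geq_mkord.
apply: eq_big => [i|i _]; first by rewrite /= andbC.
by rewrite mulr_sumr; apply: eq_bigr => t _; rewrite big_cons mulrCA.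
Qed.

Lemma tuple_sum_const m N : (N <= p)%N ->
  tuple_sum (fun=> 1) m N = nested u b (fun=> 1) m N.
Proof.
elim: m N => [|m IHm] N Np; first by rewrite tuple_sum0.
rewrite tuple_sumS //; apply: eq_big_nat => n nN; rewrite IHm //.
by have := b_le n; lia.
Qed.

Lemma tuple_sumZ c W m N : tuple_sum (fun s => c * W s) m N = c * tuple_sum W m N.
Proof. by rewrite /tuple_sum mulr_sumr; apply: eq_bigr => t _; rewrite mulrA. Qed.

Lemma tuple_sum_head F m N : (N <= p)%N ->
  tuple_sum (fun s => F (head 0%N s)) m.+1 N =
  \sum_(1 <= n < N) u n * (F n * nested u b (fun=> 1) m (b n)).
Proof.
move=> Np; rewrite tuple_sumS //; apply: eq_big_nat => n nN /=.
rewrite -tuple_sum_const; last by have := b_le n; lia.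
by rewrite -(tuple_sumZ (F n)); congr (_ * _); apply: eq_bigr => t _; rewrite mulr1.
Qed.

(** The last entry is tracked through the induction as the last entry of n
    followed by the remaining tuple, so that for the empty tuple the weight
    is F n, which [nested] reads off the bound b n. *)
Lemma tuple_sum_last F G m N : (forall n, G (b n) = F n) -> (N <= p)%N ->
  tuple_sum (fun s => F (last 0%N s)) m.+1 N = nested u b G m.+1 N.
Proof.
move=> GF Np; rewrite tuple_sumS //; apply: eq_big_nat => n nN; congr (_ * _).
have {nN} : (b n <= p)%N by have := b_le n; lia.
rewrite /=; elim: m n => [|m IHm] n bn; first by rewrite tuple_sum0 /= GF.
rewrite tuple_sumS //; apply: eq_big_nat => i ib /=; rewrite IHm //.
by have := b_le i; lia.
Qed.
End TupleSums.

(** * Reduction of p-integral rationals *)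

Section Reduction.
Variable p : primes_t.
Local Notation Zp2 := 'Z_(val p ^ 2).

(** The graph of the ring morphism from the localization of Z at p to Z/p^2,
    as a relation so that p-integrality and the value of the residue are
    established together. *)
Definition reduces_to (x : rat) (y : Zp2) : Prop :=
  exists a d : int, [/\ ~~ (val p %| `|d|)%N, x = a%:~R / d%:~R & y = a%:~R / d%:~R].

Lemma reduces_to_red x y : reduces_to x y -> red p x = y.
Proof. by case=> a [d [pd -> ->]]; apply: red_frac. Qed.

Lemma ndvd_intr d : ~~ (val p %| `|d|)%N -> d%:~R != 0 :> rat.
Proof. by move=> pd; rewrite intr_eq0; apply: contraNneq pd => ->. Qed.

Lemma ndvdM c d : ~~ (val p %| `|c|)%N -> ~~ (val p %| `|d|)%N ->
  ~~ (val p %| `|(c * d)%R|)%N.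
Proof. by move=> pc pd; rewrite abszM Euclid_dvdM ?(valP p) // negb_or pc. Qed.

Lemma reduces_toD x y x' y' :
  reduces_to x y -> reduces_to x' y' -> reduces_to (x + x') (y + y').
Proof.
case=> a [d [pd -> ->]] [a' [d' [pd' -> ->]]].
exists (a * d' + a' * d), (d * d'); split; first exact: ndvdM.
  by rewrite rmorphD !rmorphM addf_div ?ndvd_intr.
have ud := red_unit pd; have ud' := red_unit pd'.
rewrite rmorphD !rmorphM /= invrM // mulrDl !mulrA mulrK // [a'%:~R * _ / _]mulrAC.
by congr (_ + _); rewrite mulrK.
Qed.

Lemma reduces_toM x y x' y' :
  reduces_to x y -> reduces_to x' y' -> reduces_to (x * x') (y * y').
Proof.
case=> a [d [pd -> ->]] [a' [d' [pd' -> ->]]].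
exists (a * a'), (d * d'); split; first exact: ndvdM.
  by rewrite !rmorphM mulf_div.
rewrite !rmorphM /= invrM ?red_unit // [_^-1 * _^-1]mulrC; exact: mulrACA.
Qed.

Lemma reduces_to_int (z : int) : reduces_to z%:~R z%:~R.
Proof.
exists z, 1; split; rewrite ?divr1 //.
by rewrite dvdn1 gtn_eqF // prime_gt1 // (valP p).
Qed.

Lemma reduces_to_nat (n : nat) : reduces_to n%:R n%:R.
Proof. by have := reduces_to_int n. Qed.

Lemma reduces_toN x y : reduces_to x y -> reduces_to (- x) (- y).
Proof.
by move=> xy; rewrite -mulN1r -[- y]mulN1r; apply: reduces_toM xy; exact: (reduces_to_int (-1)).
Qed.

Lemma reduces_toB x y x' y' :
  reduces_to x y -> reduces_to x' y' -> reduces_to (x - x') (y - y').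
Proof. by move=> xy xy'; apply: reduces_toD => //; apply: reduces_toN. Qed.

Lemma reduces_toV n : (0 < n < val p)%N -> reduces_to n%:R^-1 n%:R^-1.
Proof.
move=> np; exists 1, n; split; rewrite ?mul1r //.
by rewrite gtnNdvd //; lia.
Qed.

Lemma reduces_toX x y k : reduces_to x y -> reduces_to (x ^+ k) (y ^+ k).
Proof.
move=> xy; elim: k => [|k IHk]; first exact: (reduces_to_nat 1).
by rewrite !exprS; apply: reduces_toM.
Qed.

Lemma reduces_to_sum I (r : seq I) (P : pred I) (F : I -> rat) (G : I -> Zp2) :
  (forall i, P i -> reduces_to (F i) (G i)) ->
  reduces_to (\sum_(i <- r | P i) F i) (\sum_(i <- r | P i) G i).
Proof.
by move=> FG; apply: (big_ind2 reduces_to) => //; [exact: (reduces_to_nat 0)|exact: reduces_toD].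
Qed.

Lemma natr_unit_Zp2 n : (0 < n < val p)%N -> (n%:R : Zp2) \is a GRing.unit.
Proof. by move=> np; apply: (@red_unit p n); rewrite gtnNdvd //; lia. Qed.

Lemma p_sq0_Zp2 : (val p)%:R * (val p)%:R = 0 :> Zp2.
Proof. by rewrite -natrM mulnn pchar_Zp // prime_sqr_gt1. Qed.

(** An element killed by p has a multiple of p as its representative. *)
Lemma ann_p_mul_Zp2 (x y : Zp2) :
  (val p)%:R * x = 0 -> (val p)%:R * y = 0 -> x * y = 0.
Proof.
have dvd_ann (z : Zp2) : (val p)%:R * z = 0 -> exists k : nat, z = (val p)%:R * k%:R.
  move=> pz0; exists (z %/ val p)%N; rewrite -natrM mulnC divnK ?natr_Zp //.
  have /(congr1 (@nat_of_ord _)) : ((val p * z)%N%:R : Zp2) = 0.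
    by rewrite natrM natr_Zp.
  rewrite val_Zp_nat ?prime_sqr_gt1 // => /eqP.
  move: (nat_of_ord z) => k.
  by rewrite -/(dvdn _ _) expnS dvdn_pmul2l ?prime_gt0 ?(valP p) // expn1.
move=> /dvd_ann[k ->] /dvd_ann[l ->].
by rewrite mulrACA p_sq0_Zp2 mul0r.
Qed.

Lemma fmp_sum_reduces (e : rel nat) expo m (r : rat) (s : Zp2) : reduces_to r s ->
  reduces_to (fmp_sum e expo m r (val p))
   (tuple_sum (recip Zp2) (val p) e (fun t => s ^+ expo t) m (val p)).
Proof.
move=> rs; rewrite /fmp_sum /tuple_sum /index_set.
under eq_bigl => t do rewrite inE.
rewrite [X in reduces_to _ X](eq_bigl (fun t : m.-tuple 'I_(val p) =>
    sorted e [seq val i | i <- t] && all (fun i : 'I_(val p) => 0 < i)%N t)); last first.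
  by move=> t; congr (_ && _); apply: eq_all => i; rewrite ltn_ord andbT.
apply: reduces_to_sum => t /andP[_ /allP t_gt0].
apply: reduces_toM; first exact: reduces_toX.
rewrite -prodfV; have : all (fun i : 'I_(val p) => 0 < i)%N t by apply/allP.
elim: (tval t) => [_|i l IHl /= /andP[i_gt0 l_gt0]].
  by rewrite !big_nil; exact: (reduces_to_nat 1).
rewrite !big_cons; apply: reduces_toM; last exact: IHl.
by apply: reduces_toV; rewrite i_gt0 ltn_ord.
Qed.
End Reduction.

(** * Bernoulli numbers modulo p ^ 2 *)

Lemma bernoulli_rec k :
  \sum_(i < k.+1) 'C(k.+1, i)%:R * bernoulli i = k.+1%:R.
Proof.
rewrite big_ord_recr /= binSn [bernoulli k]bernoulliE mulrBr mulr1 addrC -addrA.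
rewrite mulr_sumr -sumrN -big_split big1 ?addr0 // => i _ /=.
have ik := ltn_ord i.
have d0 : (k.+1 - i)%:R != 0 :> rat by rewrite pnatr_eq0; lia.
have := congr1 (fun n => n%:R : rat) (mul_bin_down k.+1 i); rewrite !natrM /=.
move: (k.+1 - i)%:R d0 => d d0 E.
have -> : 'C(k.+1, i)%:R = k.+1%:R * 'C(k, i)%:R / d :> rat by rewrite E mulrC mulKf.
ring.
Qed.

(** In the recursion for B_k only denominators at most k + 1 < p occur. *)
Lemma reduces_to_bernoulli (p : primes_t) k : (k < (val p).-1)%N ->
  reduces_to (bernoulli k) (red p (bernoulli k)).
Proof.
elim/ltn_ind: k => k IHk kp.
have [y ky] : exists y, reduces_to (p := p) (bernoulli k) y.
  exists (1 - \sum_(i < k) 'C(k, i)%:R * red p (bernoulli i) * (k.+1 - i)%:R^-1).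
  rewrite bernoulliE; apply: reduces_toB; first exact: (reduces_to_nat p 1).
  apply: reduces_to_sum => i _; have ik := ltn_ord i.
  apply: reduces_toM; last by apply: reduces_toV; lia.
  by apply: reduces_toM; [exact: reduces_to_nat | apply: IHk; lia].
by rewrite (reduces_to_red ky).
Qed.

Lemma red_bernoulli_rec (p : primes_t) k : (k < (val p).-1)%N ->
  \sum_(i < k.+1) 'C(k.+1, i)%:R * red p (bernoulli i) = k.+1%:R.
Proof.
move=> kp; have := reduces_to_red (reduces_to_nat p k.+1); rewrite -bernoulli_rec => <-.
apply/esym/reduces_to_red/reduces_to_sum => i _; apply: reduces_toM; first exact: reduces_to_nat.
by apply: reduces_to_bernoulli; apply: leq_ltn_trans kp; rewrite -ltnS.
Qed.

(** * Components of the finite polylogarithms *)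

Section Components.
Variables (p : primes_t) (m : nat).
Hypotheses (m_gt0 : (0 < m)%N) (m_even : ~~ odd m) (mp : (m.+2 < val p)%N).
Local Notation Zp2 := 'Z_(val p ^ 2).
Local Notation v := (recip Zp2).

Let p_odd : odd (val p).
Proof. by case: (even_prime (valP p)) => // p2; move: mp; rewrite p2. Qed.

Lemma red_polylog (s : Zp2) (r : rat) : reduces_to r s ->
  red p (fmp_sum gtn (head 0%N) m r (val p)) =
  \sum_(1 <= n < val p) v n * (s ^+ n * elsym v m.-1 n).
Proof.
move=> rs; rewrite (reduces_to_red (fmp_sum_reduces _ _ _ rs)) -{1}(prednK m_gt0).
have gtn_trans : transitive gtn by exact: rev_trans ltn_trans.
exact: (@tuple_sum_head _ v _ gtn id gtn_trans _ _ (fun n => s ^+ n)).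
Qed.

Lemma red_polylog_tilde (s : Zp2) (r : rat) : reduces_to r s ->
  red p (fmp_sum gtn (last 0%N) m r (val p)) = nested v id (fun i => s ^+ i) m (val p).
Proof.
move=> rs; rewrite (reduces_to_red (fmp_sum_reduces _ _ _ rs)) -(prednK m_gt0).
have gtn_trans : transitive gtn by exact: rev_trans ltn_trans.
exact: (@tuple_sum_last _ v _ gtn id gtn_trans _ _ (fun n => s ^+ n)).
Qed.

Lemma red_polylog_star (s : Zp2) (r : rat) : reduces_to r s ->
  red p (fmp_sum geq (head 0%N) m r (val p)) =
  \sum_(1 <= n < val p) v n * (s ^+ n * hsym v m.-1 n.+1).
Proof.
move=> rs; rewrite (reduces_to_red (fmp_sum_reduces _ _ _ rs)) -{1}(prednK m_gt0).
have geq_trans : transitive geq by exact: rev_trans leq_trans.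
exact: (@tuple_sum_head _ v _ geq succn geq_trans _ _ (fun n => s ^+ n)).
Qed.

Lemma red_polylog_tilde_star (s : Zp2) (r : rat) : reduces_to r s ->
  red p (fmp_sum geq (last 0%N) m r (val p)) =
  nested v succn (fun i => s ^+ i.-1) m (val p).
Proof.
move=> rs; rewrite (reduces_to_red (fmp_sum_reduces _ _ _ rs)) -(prednK m_gt0).
have geq_trans : transitive geq by exact: rev_trans leq_trans.
exact: (@tuple_sum_last _ v _ geq succn geq_trans _ _ (fun n => s ^+ n)).
Qed.

Lemma reduces_to_half : reduces_to (p := p) 2^-1 2%:R^-1.
Proof. by apply: (@reduces_toV p 2); lia. Qed.

Lemma polylog_at_2 :
  red p (fmp_sum gtn (head 0%N) m 2 (val p)) =
  - red p (fmp_sum geq (last 0%N) m 2 (val p)).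
Proof.
rewrite (red_polylog (reduces_to_nat p 2)) (red_polylog_tilde_star (reduces_to_nat p 2)).
exact: (headsum_tilde_star (valP p) (@natr_unit_Zp2 p) (@p_sq0_Zp2 p) (@ann_p_mul_Zp2 p)
  (beta := fun i => red p (bernoulli i)) (@red_bernoulli_rec p) p_odd m_gt0 m_even mp).
Qed.

Lemma polylog_tilde_at_half :
  red p (fmp_sum gtn (last 0%N) m 2^-1 (val p)) =
  - red p (fmp_sum geq (head 0%N) m 2^-1 (val p)).
Proof.
rewrite (red_polylog_tilde reduces_to_half) (red_polylog_star reduces_to_half).
exact: (nested_headsum_star (valP p) (@natr_unit_Zp2 p) (@p_sq0_Zp2 p) (@ann_p_mul_Zp2 p)
  (beta := fun i => red p (bernoulli i)) (@red_bernoulli_rec p) p_odd m_gt0 m_even mp).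
Qed.

Let two_unit : (2%:R : Zp2) \is a GRing.unit.
Proof. by apply: natr_unit_Zp2; lia. Qed.

Let mS_unit : (m.+1%:R : Zp2) \is a GRing.unit.
Proof. by apply: natr_unit_Zp2; lia. Qed.

Lemma polylog_tilde_star_at_2 :
  - red p (fmp_sum geq (last 0%N) m 2 (val p)) =
  red p (m.+1%:R / 2 ^+ m - m%:R - 2) *
    (red p (bernoulli (val p - m.+1)) * red p m.+1%:R^-1) * (val p)%:R.
Proof.
rewrite (red_polylog_tilde_star (reduces_to_nat p 2)).
have -> : red p (m.+1%:R / 2 ^+ m - m%:R - 2) =
    m.+1%:R * 2%:R^-1 ^+ m - m%:R - 2%:R.
  apply: reduces_to_red; rewrite -exprVn; apply: reduces_toB; last exact: reduces_to_nat.
  apply: reduces_toB; last exact: reduces_to_nat.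
  by apply: reduces_toM; [exact: reduces_to_nat | apply: reduces_toX reduces_to_half].
have -> : red p m.+1%:R^-1 = m.+1%:R^-1.
  by apply/reduces_to_red/reduces_toV; lia.
have -> : (val p - m.+1 = (val p).-1 - m)%N by lia.
have := tilde_star_bernoulli (valP p) (@natr_unit_Zp2 p) (@p_sq0_Zp2 p) (@ann_p_mul_Zp2 p)
  (beta := fun i => red p (bernoulli i)) (@red_bernoulli_rec p) p_odd m_gt0 m_even mp.
move: (nested _ _ _ _ _) (red p _) => S beta SE.
have powK : 2%:R ^+ m * 2%:R^-1 ^+ m = 1 :> Zp2 by rewrite -exprMn divrr ?expr1n.
have mK : m.+1%:R * m.+1%:R^-1 = 1 :> Zp2 by rewrite divrr.
apply: (mulrI mS_unit); apply: (mulrI (unitrX m two_unit)).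
move: (m.+1%:R^-1) (2%:R^-1 ^+ m) mK powK => mV pV mK powK.
transitivity (- (2%:R ^+ m * (m.+1%:R * S))); first by ring.
rewrite SE.
transitivity ((m.+1%:R * (2%:R ^+ m * pV) - 2%:R ^+ m * (m%:R + 2%:R)) * (m.+1%:R * mV) *
  ((val p)%:R * beta)); last by ring.
rewrite powK mK; ring.
Qed.

Lemma polylog_star_at_half :
  - red p (fmp_sum geq (head 0%N) m 2^-1 (val p)) =
  red p ((1 - 2 ^+ m.+1) / 2 ^+ m.+1) *
    (red p (bernoulli (val p - m.+1)) * red p m.+1%:R^-1) * (val p)%:R.
Proof.
rewrite (red_polylog_star reduces_to_half).
have -> : red p ((1 - 2 ^+ m.+1) / 2 ^+ m.+1) = (1 - 2%:R ^+ m.+1) * 2%:R^-1 ^+ m.+1.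
  apply: reduces_to_red; rewrite -exprVn.
  apply: reduces_toM; last by apply: reduces_toX reduces_to_half.
  by apply: reduces_toB; [exact: (reduces_to_nat p 1) | apply/reduces_toX/reduces_to_nat].
have -> : red p m.+1%:R^-1 = m.+1%:R^-1.
  by apply/reduces_to_red/reduces_toV; lia.
have -> : (val p - m.+1 = (val p).-1 - m)%N by lia.
have := star_half_bernoulli (valP p) (@natr_unit_Zp2 p) (@p_sq0_Zp2 p) (@ann_p_mul_Zp2 p)
  (beta := fun i => red p (bernoulli i)) (@red_bernoulli_rec p) p_odd m_gt0 m_even mp.
move: (\sum_(1 <= n < _) _) (red p _) => S beta SE.
have powK : 2%:R ^+ m.+1 * 2%:R^-1 ^+ m.+1 = 1 :> Zp2 by rewrite -exprMn divrr ?expr1n.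
have mK : m.+1%:R * m.+1%:R^-1 = 1 :> Zp2 by rewrite divrr.
apply: (mulrI mS_unit); apply: (mulrI (unitrX m.+1 two_unit)).
move: (m.+1%:R^-1) (2%:R^-1 ^+ m.+1) mK powK => mV pV mK powK.
transitivity (- (2%:R ^+ m.+1 * (m.+1%:R * S))); first by ring.
rewrite SE.
transitivity ((1 - 2%:R ^+ m.+1) * (2%:R ^+ m.+1 * pV) * (m.+1%:R * mV) *
  ((val p)%:R * beta)); last by ring.
rewrite powK mK; ring.
Qed.
End Components.

Theorem theorem4p6 (m : nat) (m_gt0 : (0 < m)%N) (m_even : ~~ odd m) :
  [/\ polylog m 2 = - polylog_tilde_star m 2,
      - polylog_tilde_star m 2 =
        A2_of_rat (m.+1%:R / 2 ^+ m - m%:R - 2) *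
          (A2_bernoulli m.+1 * A2_of_rat m.+1%:R^-1) * A2_p,
      polylog_tilde m 2^-1 = - polylog_star m 2^-1 &
      - polylog_star m 2^-1 =
        A2_of_rat ((1 - 2 ^+ m.+1) / 2 ^+ m.+1) *
          (A2_bernoulli m.+1 * A2_of_rat m.+1%:R^-1) * A2_p].
Proof.
split; rewrite /polylog_star /polylog_tilde_star /A2_of_rat /A2_bernoulli /A2_p
  -?rmorphN -?rmorphM; apply/A2_of_eventuallyP; exists m.+3 => p mp.
- exact: polylog_at_2.
- exact: polylog_tilde_star_at_2.
- exact: polylog_tilde_at_half.
- exact: polylog_star_at_half.
Qed.
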